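(* Let $\mathcal{A}=(L\xrightarrow{\delta}E\xrightarrow{\partial}G,\triangleright,\{,\})$ and $\mathcal{A}'=(L'\xrightarrow{\delta}E'\xrightarrow{\partial}F,\triangleright,\{,\})$ be 2-crossed modules, where $F$ is a free group with a chosen basis $B$. Then there is a (strict) 2-groupoid $\mathrm{HOM}_B(\mathcal{A}',\mathcal{A})$ whose objects are the 2-crossed module maps $\mathcal{A}'\to\mathcal{A}$, whose 1-morphisms are the 1-fold homotopies between 2-crossed module maps (composed by the concatenation $\otimes$), and whose 2-morphisms are the 2-fold homotopies between 1-fold homotopies (composed vertically by $\diamond$, and whiskered on the left and on the right by 1-fold homotopies using the operations $\otimes$).
   Context: 2-crossed modules. A 2-crossed module $(L\xrightarrow{\delta}E\xrightarrow{\partial}G,\triangleright,\{,\})$ is a chain complex of groups ($\partial\circ\delta$ trivial) with left actions $\triangleright$ of $G$ by automorphisms on $L$ and $E$ ($G$ acts on itself by conjugation) such that $\delta,\partial$ are $G$-equivariant, and a $G$-equivariant map $\{,\}\colon E\times E\to L$ (so $g\triangleright\{e,f\}=\{g\triangleright e,g\triangleright f\}$) such that for all $e,f,g\in E$, $l,k\in L$: $\delta(\{e,f\})=efe^{-1}\,(\partial(e)\triangleright f^{-1})$; $lkl^{-1}k^{-1}=\{\delta(l),\delta(k)\}$; $\{\delta(l),e\}\{e,\delta(l)\}=l\,(\partial(e)\triangleright l^{-1})$; $\{ef,g\}=\{e,fgf^{-1}\}\,\partial(e)\triangleright\{f,g\}$; $\{e,fg\}=\{e,f\}\,(\partial(e)\triangleright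 f)\triangleright'\{e,g\}$, where $e\triangleright' l:=l\,\{\delta(l)^{-1},e\}$ (this is a left action of $E$ on $L$ by automorphisms). A map of 2-crossed modules $f=(\mu,\psi,\phi)$ consists of group homomorphisms on the $L$-, $E$- and $G$-groups respectively, commuting with $\delta,\partial$ and preserving the actions and the liftings $\{,\}$. Homotopies. Let $\mathcal{C}=(L_1\to E_1\to G_1)$, $\mathcal{D}=(L_2\to E_2\to G_2)$ be 2-crossed modules and $f=(\mu,\psi,\phi)\colon\mathcal{C}\to\mathcal{D}$ a map. A $\phi$-derivation is a map $s\colon G_1\to E_2$ with $s(gh)=(\phi(h)^{-1}\triangleright s(g))\,s(h)$. A quadratic $f$-derivation is a pair $(s,t)$ with $s\colon G_1\to E_2$ a $\phi$-derivation and $t\colon E_1\to L_2$ a map such that for all $a,b\in E_1$, $g\in G_1$: $$t(ab)=s(\partial(b))^{-1}\triangleright'\big(\{\psi(b)^{-1},s(\partial(a))^{-1}\}^{-1}\;\psi(b)^{-1}\triangleright' t(a)\big)\;t(b),$$ $$t(g\triangleright a)=\phi(g)\triangleright\Big(\big(s(g)s(\partial(a))^{-1}\big)\triangleright'\{\psi(a)^{-1},s(g)^{-1}\}^{-1}\Big)\;\phi(g)\triangleright\{s(g),s(\partial(a))^{-1}\psi(a)^{-1}\}\;\big(\phi(g)\partial(s(g))\big)\triangleright t(a).$$ Then $f'=(\mu',\psi',\phi')$ with $\mu'(l)=\mu(l)t(\delta(l))$, $\psi'(a)=\psi(a)s(\partial(a))\delta(t(a))$, $\phi'(g)=\phi(g)\partial(s(g))$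 is a map $\mathcal{C}\to\mathcal{D}$; one writes $f\xrightarrow{(f,s,t)}f'$ and calls $(f,s,t)$ a homotopy (1-fold homotopy) connecting $f$ and $f'$. Concatenation. Suppose $G_1$ is free with chosen basis $B$, and let $f=(\mu,\psi,\phi)\xrightarrow{(f,s,t)}f'=(\mu',\psi',\phi')\xrightarrow{(f',s',t')}f''$ be homotopies of maps $\mathcal{C}\to\mathcal{D}$. Then $s\otimes s'\colon G_1\to E_2$ is the unique $\phi$-derivation with $(s\otimes s')(b)=s(b)s'(b)$ for $b\in B$; $\omega^{(s,s')}\colon G_1\to L_2$ is the unique map $\omega$ with $\omega(b)=1$ for $b\in B$ and, for all $g,h\in G_1$, $$\omega(gh)=\omega(h)\;s'(h)^{-1}\triangleright'\Big(\big\{s(h)^{-1},\,\phi(h)^{-1}\triangleright\big(\delta(\omega(g))s'(g)^{-1}\big)\big\}\;\phi'(h)^{-1}\triangleright\omega(g)\Big);$$ $(t\otimes t')(e)=\omega^{(s,s')}(\partial(e))\;\big(s'(\partial(e))^{-1}\triangleright' t(e)\big)\;t'(e)$ for $e\in E_1$; and $(f,s,t)\otimes(f',s',t')=(f,s\otimes s',t\otimes t')$. 2-fold homotopies. For $f=(\mu,\psi,\phi)\colon\mathcal{C}\to\mathcal{D}$ and a quadratic $f$-derivation $(s,t)$, a quadratic $(f,s,t)$ 2-derivation is a map $k\colon G_1\to L_2$ with $k(gh)=\big(s(h)^{-1}\triangleright'(\phi(h)^{-1}\triangleright k(g))\big)k(h)$ for all $g,h\in G_1$. Then $s'(g)=s(g)\delta(k(g))$,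 $t'(e)=k(\partial(e))^{-1}t(e)$ is a quadratic $f$-derivation, connecting the same two maps as $(s,t)$; one writes $(f,s,t)\xrightarrow{(f,s,t,k)}(f,s',t')$ and calls $(f,s,t,k)$ a 2-fold homotopy. Vertical composition of $(f,s,t)\xrightarrow{(f,s,t,k)}(f,s',t')\xrightarrow{(f,s',t',k')}(f,s'',t'')$ is $(f,s,t,k\diamond k')$, $(k\diamond k')(g)=k(g)k'(g)$. If $G_1$ is free on $B$, a quadratic $(f,s,t)$ 2-derivation is uniquely determined by its (arbitrary) values on $B$. Whiskering ($G_1$ free on $B$). If $(f,s,t,k)$ is a 2-fold homotopy between homotopies connecting $f$ and $f'$ and $f'\xrightarrow{(f',u,v)}f''$ is a homotopy, then $(f,s,t,k)\otimes(f',u,v)=(f,s\otimes u,t\otimes v,k\otimes u)$, where $k\otimes u$ is the unique quadratic $(f,s\otimes u,t\otimes v)$ 2-derivation with $(k\otimes u)(b)=u(b)^{-1}\triangleright' k(b)$ for $b\in B$. If $f''\xrightarrow{(f'',u,v)}f$ is a homotopy, then $(f'',u,v)\otimes(f,s,t,k)=(f'',u\otimes s,v\otimes t,u\otimes k)$, where $u\otimes k$ is the unique quadratic $(f'',u\otimes s,v\otimes t)$ 2-derivation with $(u\otimes k)(b)=k(b)$ for $b\in B$. *)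

(* Defs.v *)
From HB Require Import structures.
From mathcomp Require Import all_boot.
From mathcomp Require Import boolp classical_sets.

Set Implicit Arguments.
Unset Strict Implicit.
Unset Printing Implicit Defensive.

Local Open Scope group_scope.

Definition free_basis (F : groupType) (B : set F) : Prop :=
  forall (H : groupType) (u : F -> H),
    exists! v : {multiplicative F -> H}, forall b, B b -> v b = u b.

Definition acts_by_automorphisms (G X : groupType) (act : G -> X -> X) : Prop :=
  [/\ forall x, act 1 x = x,
      forall g h x, act (g * h) x = act g (act h x)
    & forall g x y, act g (x * y) = act g x * act g y].

(* e |>' l = l {delta(l)^-1, e} *)
Definition peiffer_act (L E : groupType) (delta : L -> E) (lifting : E -> E -> L)
  (e : E) (l : L) : L := l * lifting (delta l)^-1 e.

Record xmod2 := XMod2 {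
  grpL : groupType;
  grpE : groupType;
  grpG : groupType;
  delta : {multiplicative grpL -> grpE};
  del : {multiplicative grpE -> grpG};
  actL : grpG -> grpL -> grpL;
  actE : grpG -> grpE -> grpE;
  lifting : grpE -> grpE -> grpL;
  del_delta : forall l, del (delta l) = 1;
  actL_aut : acts_by_automorphisms actL;
  actE_aut : acts_by_automorphisms actE;
  delta_act : forall g l, delta (actL g l) = actE g (delta l);
  del_act : forall g e, del (actE g e) = g * del e * g^-1;
  lifting_act : forall g e f,
    actL g (lifting e f) = lifting (actE g e) (actE g f);
  delta_lifting : forall e f,
    delta (lifting e f) = e * f * e^-1 * actE (del e) f^-1;
  lifting_delta : forall l k,
    l * k * l^-1 * k^-1 = lifting (delta l) (delta k);
  lifting_delta_sym : forall l e,
    lifting (delta l) e * lifting e (delta l) = l * actL (del e) l^-1;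
  lifting_mull : forall e f g,
    lifting (e * f) g = lifting e (f * g * f^-1) * actL (del e) (lifting f g);
  lifting_mulr : forall e f g,
    lifting e (f * g) =
      lifting e f * peiffer_act delta lifting (actE (del e) f) (lifting e g)
}.

Arguments delta {x}.
Arguments del {x}.

Notation "g |>L l" := (actL g l)
  (at level 35, right associativity) : group_scope.
Notation "g |>E e" := (actE g e)
  (at level 35, right associativity) : group_scope.
Notation "e |>' l" := (peiffer_act (@delta _) (@lifting _) e l)
  (at level 35, right associativity) : group_scope.

Record xmod2_map (C D : xmod2) := XMod2Map {
  mapL : {multiplicative grpL C -> grpL D};
  mapE : {multiplicative grpE C -> grpE D};
  mapG : {multiplicative grpG C -> grpG D};
  map_delta : forall l, delta (mapL l) = mapE (delta l);
  map_del : forall e, del (mapE e) = mapG (del e);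
  map_actL : forall g l, mapL (g |>L l) = mapG g |>L mapL l;
  map_actE : forall g e, mapE (g |>E e) = mapG g |>E mapE e;
  map_lifting : forall e f, mapL (lifting e f) = lifting (mapE e) (mapE f)
}.

Definition is_derivation (C D : xmod2) (phi : grpG C -> grpG D)
    (s : grpG C -> grpE D) : Prop :=
  forall g h, s (g * h) = ((phi h)^-1 |>E s g) * s h.

Definition is_quadratic_derivation (C D : xmod2) (f : xmod2_map C D)
    (s : grpG C -> grpE D) (t : grpE C -> grpL D) : Prop :=
  [/\ is_derivation (mapG f) s,
      forall a b,
        t (a * b) =
          ((s (del b))^-1 |>'
             ((lifting (mapE f b)^-1 (s (del a))^-1)^-1
              * ((mapE f b)^-1 |>' t a)))
          * t b
    & forall g a,
        t (g |>E a) =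
          (mapG f g |>L
             ((s g * (s (del a))^-1) |>' (lifting (mapE f a)^-1 (s g)^-1)^-1))
          * (mapG f g |>L lifting (s g) ((s (del a))^-1 * (mapE f a)^-1))
          * ((mapG f g * del (s g)) |>L t a)].

(* The triple (f, s, t); its target is determined by [is_target]. *)
Record homotopy (C D : xmod2) := Homotopy {
  hmap : xmod2_map C D;
  hs : grpG C -> grpE D;
  ht : grpE C -> grpL D;
  h_quadratic : is_quadratic_derivation hmap hs ht
}.

(* [is_target h f'] : the homotopy [h] = (f, s, t) connects f to [f']. *)
Definition is_target (C D : xmod2) (h : homotopy C D) (f' : xmod2_map C D)
    : Prop :=
  [/\ forall l, mapL f' l = mapL (hmap h) l * ht h (delta l),
      forall a, mapE f' a = mapE (hmap h) a * hs h (del a) * delta (ht h a)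
    & forall g, mapG f' g = mapG (hmap h) g * del (hs h g)].

Definition is_omega (C D : xmod2) (B : set (grpG C)) (h h' : homotopy C D)
    (w : grpG C -> grpL D) : Prop :=
  (forall b, B b -> w b = 1) /\
  forall x y,
    w (x * y) =
      w y * ((hs h' y)^-1 |>'
        (lifting (hs h y)^-1
                 ((mapG (hmap h) y)^-1 |>E (delta (w x) * (hs h' x)^-1))
         * ((mapG (hmap h') y)^-1 |>L w x))).

(* [is_concat B h h' c] : [c] is the concatenation [h (x) h'], for [hmap h'] the
   target of [h] and [B] a free basis. *)
Definition is_concat (C D : xmod2) (B : set (grpG C)) (h h' c : homotopy C D)
    : Prop :=
  [/\ hmap c = hmap h,
      unique (fun u : grpG C -> grpE D =>
                is_derivation (mapG (hmap h)) u /\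
                forall b, B b -> u b = hs h b * hs h' b) (hs c)
    & exists2 w : grpG C -> grpL D, unique (is_omega B h h') w &
        forall e, ht c e =
          w (del e) * ((hs h' (del e))^-1 |>' ht h e) * ht h' e].

Definition is_2derivation (C D : xmod2) (h : homotopy C D)
    (k : grpG C -> grpL D) : Prop :=
  forall x y,
    k (x * y) =
      ((hs h y)^-1 |>' ((mapG (hmap h) y)^-1 |>L k x)) * k y.

(* The quadruple (f, s, t, k), with [khom] = (f, s, t); its target is determined
   by [is_target2]. *)
Record homotopy2 (C D : xmod2) := Homotopy2 {
  khom : homotopy C D;
  kfun : grpG C -> grpL D;
  k_2derivation : is_2derivation khom kfun
}.

Definition is_target2 (C D : xmod2) (a : homotopy2 C D) (h' : homotopy C D)
    : Prop :=
  [/\ hmap h' = hmap (khom a),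
      forall g, hs h' g = hs (khom a) g * delta (kfun a g)
    & forall e, ht h' e = (kfun a (del e))^-1 * ht (khom a) e].

Definition is_vcomp (C D : xmod2) (a b c : homotopy2 C D) : Prop :=
  khom c = khom a /\ forall g, kfun c g = kfun a g * kfun b g.

(* In the two whiskerings, [hc] stands for the concatenation of the source of
   [a] with [h], resp. of [h] with the source of [a]. *)
Definition is_whiskr (C D : xmod2) (B : set (grpG C)) (a : homotopy2 C D)
    (h hc : homotopy C D) (c : homotopy2 C D) : Prop :=
  khom c = hc /\
  unique (fun k : grpG C -> grpL D =>
            is_2derivation hc k /\
            forall b, B b -> k b = (hs h b)^-1 |>' kfun a b) (kfun c).

Definition is_whiskl (C D : xmod2) (B : set (grpG C)) (a : homotopy2 C D)
    (hc : homotopy C D) (c : homotopy2 C D) : Prop :=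
  khom c = hc /\
  unique (fun k : grpG C -> grpL D =>
            is_2derivation hc k /\ forall b, B b -> k b = kfun a b) (kfun c).

Unset Implicit Arguments.

(* Strict 2-categories with sets of cells [C0], [C1], [C2], presented by
   vertical composition and whiskering; the horizontal composite of 2-cells
   [a] and [b] is either side of [interchange].  Compositions are written in
   diagrammatic order and take a proof of composability; each law holds for
   any choice of these proofs, which avoids transporting cells along equalities
   between their boundaries. *)
Record strict_2category (C0 C1 C2 : Type) := Strict2Category {
  dom1 : C1 -> C0;
  cod1 : C1 -> C0;
  id1 : C0 -> C1;
  comp1 : forall f g : C1, cod1 f = dom1 g -> C1;
  dom1_id : forall x, dom1 (id1 x) = x;
  cod1_id : forall x, cod1 (id1 x) = x;
  dom1_comp : forall f g p, dom1 (comp1 f g p) = dom1 f;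
  cod1_comp : forall f g p, cod1 (comp1 f g p) = cod1 g;
  comp1_idl : forall f p, comp1 (id1 (dom1 f)) f p = f;
  comp1_idr : forall f p, comp1 f (id1 (cod1 f)) p = f;
  comp1A : forall f g h p q p' q',
    comp1 (comp1 f g p) h q' = comp1 f (comp1 g h q) p';

  dom2 : C2 -> C1;
  cod2 : C2 -> C1;
  dom1_cod2 : forall a, dom1 (cod2 a) = dom1 (dom2 a);
  cod1_cod2 : forall a, cod1 (cod2 a) = cod1 (dom2 a);
  id2 : C1 -> C2;
  comp2 : forall a b : C2, cod2 a = dom2 b -> C2;
  dom2_id : forall f, dom2 (id2 f) = f;
  cod2_id : forall f, cod2 (id2 f) = f;
  dom2_comp : forall a b p, dom2 (comp2 a b p) = dom2 a;
  cod2_comp : forall a b p, cod2 (comp2 a b p) = cod2 b;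
  comp2_idl : forall a p, comp2 (id2 (dom2 a)) a p = a;
  comp2_idr : forall a p, comp2 a (id2 (cod2 a)) p = a;
  comp2A : forall a b c p q p' q',
    comp2 (comp2 a b p) c q' = comp2 a (comp2 b c q) p';

  whiskr : forall (a : C2) (g : C1), cod1 (dom2 a) = dom1 g -> C2;
  dom2_whiskr : forall a g p, dom2 (whiskr a g p) = comp1 (dom2 a) g p;
  cod2_whiskr : forall a g p p', cod2 (whiskr a g p) = comp1 (cod2 a) g p';
  whiskr_id2 : forall f g p p', whiskr (id2 f) g p' = id2 (comp1 f g p);
  whiskr_comp2 : forall a b g p q q' q'' p',
    whiskr (comp2 a b p) g q = comp2 (whiskr a g q') (whiskr b g q'') p';
  whiskr_id1 : forall a p, whiskr a (id1 (cod1 (dom2 a))) p = a;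
  whiskr_comp1 : forall a g h p q q' p',
    whiskr a (comp1 g h p) q = whiskr (whiskr a g q') h p';

  whiskl : forall (f : C1) (a : C2), cod1 f = dom1 (dom2 a) -> C2;
  dom2_whiskl : forall f a p, dom2 (whiskl f a p) = comp1 f (dom2 a) p;
  cod2_whiskl : forall f a p p', cod2 (whiskl f a p) = comp1 f (cod2 a) p';
  whiskl_id2 : forall f g p p', whiskl f (id2 g) p' = id2 (comp1 f g p);
  whiskl_comp2 : forall f a b p q q' q'' p',
    whiskl f (comp2 a b p) q = comp2 (whiskl f a q') (whiskl f b q'') p';
  whiskl_id1 : forall a p, whiskl (id1 (dom1 (dom2 a))) a p = a;
  whiskl_comp1 : forall f g a p q q' p',
    whiskl (comp1 f g p) a q = whiskl f (whiskl g a q') p';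

  whisklr : forall f a h p q q' p',
    whiskr (whiskl f a p) h q = whiskl f (whiskr a h q') p';
  interchange : forall a b p p' q q' r r',
    comp2 (whiskr a (dom2 b) p) (whiskl (cod2 a) b q) r =
    comp2 (whiskl (dom2 a) b q') (whiskr a (cod2 b) p') r'
}.

Set Implicit Arguments.

Arguments dom1 {C0 C1 C2} _ _.
Arguments cod1 {C0 C1 C2} _ _.
Arguments id1 {C0 C1 C2} _ _.
Arguments comp1 {C0 C1 C2} _ _ _ _.
Arguments dom2 {C0 C1 C2} _ _.
Arguments cod2 {C0 C1 C2} _ _.
Arguments id2 {C0 C1 C2} _ _.
Arguments comp2 {C0 C1 C2} _ _ _ _.
Arguments whiskr {C0 C1 C2} _ _ _ _.
Arguments whiskl {C0 C1 C2} _ _ _ _.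

Definition is_2groupoid (C0 C1 C2 : Type) (X : strict_2category C0 C1 C2)
    : Prop :=
  (forall f, exists g (p : cod1 X f = dom1 X g) (q : cod1 X g = dom1 X f),
     comp1 X f g p = id1 X (dom1 X f) /\ comp1 X g f q = id1 X (cod1 X f)) /\
  (forall a, exists b (p : cod2 X a = dom2 X b) (q : cod2 X b = dom2 X a),
     comp2 X a b p = id2 X (dom2 X a) /\ comp2 X b a q = id2 X (cod2 X a)).

(* Main.v *)
(* A 2-crossed module is the Moore complex of a simplicial group whose level 2
   consists of triangles: products g u° v̄ κ(l) with g in G, u° and v̄ in the two
   degenerate copies of E, and κ(l) = (δ l)‾ l^-1, which has the consecutive
   edges u : g -> g ∂u and v, and the long edge u v δ(l).  All the data of the
   paper are group homomorphisms into this group: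
   - a derivation s is the edge g |-> (φ g, s g);
   - the product rule for t says that a |-> ψ(a)° (s ∂a)‾ κ(t a) is multiplicative;
   - the recursion for ω says that x |-> φ(x) s(x)° s'(x)‾ κ(ω x)^-1 is;
   - a 2-derivation k gives the triangle φ(x) (s(x) δ(k x))‾ κ(k x)^-1.
   Tetrahedra (quadruples of matching triangles that satisfy one cocycle equation)
   are closed under products because level 3 has no new cells.  Hence if three
   faces of a family of tetrahedra depend multiplicatively on the parameter, so
   does the fourth.  Concatenation, inverses, targets of 2-fold homotopies,
   associativity and both whiskerings are instances of this, and since F is free,
   the remaining equations between derivations are checked on B only. *)

From HB Require Import structures.
Require Import Defs.
From mathcomp Require Import all_boot.
From mathcomp Require Import boolp classical_sets.

Set Implicit Arguments.
Unset Strict Implicit.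
Unset Printing Implicit Defensive.

Local Open Scope group_scope.

(** * Morphisms, actions by automorphisms and semidirect products of groups *)

Lemma mulg_idem (G : groupType) (x : G) : x = x * x -> x = 1.
Proof. by move=> xx; apply: (@mulgI _ x); rewrite mulg1 -xx. Qed.

Section Morphism.
Variables (G H : groupType) (f : G -> H).
Hypothesis fM : {morph f : x y / x * y}.

Lemma morphg1 : f 1 = 1.
Proof. by apply: (@mulgI _ (f 1)); rewrite -fM !mulg1. Qed.

Lemma morphgV x : f x^-1 = (f x)^-1.
Proof. by apply: (@mulgI _ (f x)); rewrite -fM !mulgV morphg1. Qed.
End Morphism.

Section Multiplicative.
Variables (G H : groupType) (f : {multiplicative G -> H}).

Lemma mfM x y : f (x * y) = f x * f y. Proof. exact: gmulfM. Qed.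
Lemma mf1 : f 1 = 1. Proof. exact: morphg1 mfM. Qed.
Lemma mfV x : f x^-1 = (f x)^-1. Proof. exact: morphgV mfM x. Qed.
End Multiplicative.

Section Action.
Variables (G X : groupType) (act : G -> X -> X).
Hypothesis actP : acts_by_automorphisms act.

Lemma aact1 x : act 1 x = x. Proof. by case: actP. Qed.
Lemma aactA g h x : act (g * h) x = act g (act h x). Proof. by case: actP. Qed.
Lemma aactM g x y : act g (x * y) = act g x * act g y. Proof. by case: actP. Qed.
Lemma aactg1 g : act g 1 = 1.
Proof. by apply: (@mulgI _ (act g 1)); rewrite -aactM !mulg1. Qed.
Lemma aactV g x : act g x^-1 = (act g x)^-1.
Proof. by apply: (@mulgI _ (act g x)); rewrite -aactM !mulgV aactg1. Qed.
Lemma aactK g x : act g^-1 (act g x) = x.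
Proof. by rewrite -aactA mulVg aact1. Qed.
Lemma aactVK g x : act g (act g^-1 x) = x.
Proof. by rewrite -aactA mulgV aact1. Qed.
End Action.

(** A pair stands for the product h n with the normal factor on the right, so that the second
    coordinate multiplies by the derivation rule. The proof [actP] is a parameter of the type so
    that the group structure can be inferred from it. *)
Record sdprod (H N : groupType) (act : H -> N -> N)
  (actP : acts_by_automorphisms act) := Sd { sd1 : H; sd2 : N }.

Section Sdprod.
Variables (H N : groupType) (act : H -> N -> N).
Hypothesis actP : acts_by_automorphisms act.

Definition sd_pair (x : sdprod actP) := (sd1 x, sd2 x).
Definition pair_sd (x : H * N) : sdprod actP := Sd actP x.1 x.2.
Fact sd_pairK : cancel sd_pair pair_sd. Proof. by case. Qed.

HB.instance Definition _ := Choice.copy (sdprod actP) (can_type sd_pairK).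

Definition sd_mul (x y : sdprod actP) : sdprod actP :=
  Sd actP (sd1 x * sd1 y) (act (sd1 y)^-1 (sd2 x) * sd2 y).
Definition sd_one : sdprod actP := Sd actP 1 1.
Definition sd_inv (x : sdprod actP) : sdprod actP :=
  Sd actP (sd1 x)^-1 (act (sd1 x) (sd2 x)^-1).

Fact sd_mulA : associative sd_mul.
Proof.
by move=> x y z; rewrite /sd_mul /= invgM (aactA actP) (aactM actP) !mulgA.
Qed.
Fact sd_mul1g : left_id sd_one sd_mul.
Proof. by move=> [x y]; rewrite /sd_mul /= (aactg1 actP) !mul1g. Qed.
Fact sd_mulg1 : right_id sd_one sd_mul.
Proof. by move=> [x y]; rewrite /sd_mul /= invg1 (aact1 actP) !mulg1. Qed.
Fact sd_mulVg : left_inverse sd_one sd_inv sd_mul.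
Proof. by move=> [x y]; rewrite /sd_mul /= (aactK actP) !mulVg. Qed.
Fact sd_mulgV : right_inverse sd_one sd_inv sd_mul.
Proof.
move=> [x y]; rewrite /sd_mul /= invgK.
by rewrite -(aactM actP) !mulgV (aactg1 actP).
Qed.

HB.instance Definition _ :=
  isGroup.Build (sdprod actP) sd_mulA sd_mul1g sd_mulg1 sd_mulVg sd_mulgV.

Lemma sdM h n h' n' :
  Sd actP h n * Sd actP h' n' = Sd actP (h * h') (act h'^-1 n * n').
Proof. by []. Qed.

Lemma sdV h n : (Sd actP h n)^-1 = Sd actP h^-1 (act h n^-1).
Proof. by []. Qed.
End Sdprod.

(* The action |>' of the paper, locked because rewriting would otherwise match its
   body [l * _] against every product. *)
HB.lock Definition pact (A : xmod2) (e : grpE A) (l : grpL A) : grpL A :=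
  peiffer_act (@delta A) (@lifting A) e l.

Notation "e |>p l" := (pact e l)
  (at level 35, right associativity) : group_scope.

(** * The group of triangles *)

Section Xmod2.
Variable A : xmod2.
Implicit Types (g h : grpG A) (e f u v w : grpE A) (l k m n : grpL A).

Definition actLM := aactM (actL_aut A).
Definition actLA := aactA (actL_aut A).
Definition actL1 := aact1 (actL_aut A).
Definition actLg1 := aactg1 (actL_aut A).
Definition actLV := aactV (actL_aut A).
Definition actLK := aactK (actL_aut A).
Definition actLVK := aactVK (actL_aut A).
Definition actEM := aactM (actE_aut A).
Definition actEA := aactA (actE_aut A).
Definition actE1 := aact1 (actE_aut A).
Definition actEg1 := aactg1 (actE_aut A).
Definition actEV := aactV (actE_aut A).
Definition actEK := aactK (actE_aut A).
Definition actEVK := aactVK (actE_aut A).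

Lemma liftingMr e f u :
  lifting e (f * u) = lifting e f * ((del e |>E f) |>p lifting e u).
Proof. by rewrite lifting_mulr pact.unlock. Qed.

Lemma lifting_delta1 l : lifting (delta l) 1 = 1.
Proof. by rewrite -[X in lifting _ X](mf1 (@delta A)) -lifting_delta !gsimp. Qed.

Lemma pactE e l : e |>p l = l * lifting (delta l^-1) e.
Proof. by rewrite pact.unlock /peiffer_act mfV. Qed.

Lemma pact1 l : 1 |>p l = l.
Proof. by rewrite pactE lifting_delta1 mulg1. Qed.

Lemma lifting1r e : lifting e 1 = 1.
Proof.
by apply: mulg_idem; rewrite -{1}(mulg1 (1 : grpE A)) liftingMr actEg1 pact1.
Qed.

Lemma lifting1l e : lifting 1 e = 1.
Proof.
apply: mulg_idem; rewrite -{1}(mulg1 (1 : grpE A)) lifting_mull.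
by rewrite mf1 actL1 !gsimp.
Qed.

Lemma delta_pact e l : delta (e |>p l) = e * delta l * e^-1.
Proof.
rewrite pactE mfM delta_lifting del_delta actE1.
by rewrite mfV !gnorm.
Qed.

Lemma pact_delta l m : delta l |>p m = l * m * l^-1.
Proof. by rewrite pactE -lifting_delta !gnorm. Qed.

(** The core is [E1], obtained by expanding {δ(m)^-1, e δ(l)} in two ways, using e δ(l) = δ(e |>' l)
    e. It is then inserted in the expansion of {δ(m)^-1 δ(l)^-1, e} by [lifting_mull]. *)
Lemma pactM e l m : e |>p (l * m) = (e |>p l) * (e |>p m).
Proof.
have lift_mul l0 f f' : lifting (delta l0) (f * f') =
    lifting (delta l0) f * (f |>p lifting (delta l0) f').
  by rewrite liftingMr del_delta actE1.
have E1 : lifting (delta m^-1) e * (e |>p (m^-1 * l * m * l^-1)) =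
    m^-1 * (e |>p l) * (e |>p m) * (e |>p l)^-1.
  transitivity (lifting (delta m^-1) (e * delta l)).
    by rewrite lift_mul -lifting_delta invgK.
  have -> : e * delta l = delta (e |>p l) * e by rewrite delta_pact !gnorm.
  rewrite lift_mul -lifting_delta pact_delta.
  by rewrite (pactE e m) !gnorm.
have {1}-> : e |>p (l * m) = l * m * lifting (delta m^-1 * delta l^-1) e.
  by rewrite pactE -mfM invgM.
rewrite lifting_mull del_delta actL1.
have -> : delta l^-1 * e * (delta l^-1)^-1 = delta l^-1 * (e * delta l).
  by rewrite mfV invgK mulgA.
rewrite !lift_mul -!lifting_delta pact_delta invgK E1.
have -> : lifting (delta l^-1) e = l^-1 * (e |>p l).
  by rewrite pactE mulKg.
by rewrite !gnorm.
Qed.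

Lemma pactA e f l : (e * f) |>p l = e |>p (f |>p l).
Proof.
rewrite (pactE f) pactM [in LHS]pactE [e |>p l in RHS]pactE.
by rewrite liftingMr del_delta actE1 mulgA.
Qed.

Fact pact_aut : acts_by_automorphisms (@pact A).
Proof. by split; [exact: pact1 | exact: pactA | exact: pactM]. Qed.

Definition pactg1 := aactg1 pact_aut.
Definition pactV := aactV pact_aut.
Definition pactK := aactK pact_aut.
Definition pactVK := aactVK pact_aut.

Lemma act_pact g e l : g |>L (e |>p l) = (g |>E e) |>p (g |>L l).
Proof. by rewrite !pactE actLM lifting_act -delta_act actLV. Qed.

Lemma lifting_deltal l f : lifting (delta l) f = l * (f |>p l)^-1.
Proof. by rewrite -pactV pactE invgK mulVKg. Qed.

Lemma lifting_deltar e l : lifting e (delta l) = (e |>p l) * (del e |>L l)^-1.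
Proof.
rewrite -actLV; have := lifting_delta_sym l e.
rewrite lifting_deltal => /(canRL (mulKg _)) ->.
by rewrite !gnorm.
Qed.

Lemma liftingVr e f :
  lifting e f^-1 = ((del e |>E f)^-1 |>p lifting e f)^-1.
Proof.
have := liftingMr e f f^-1; rewrite mulgV lifting1r => H.
rewrite -[LHS](pactK (del e |>E f)) -pactV; congr (_ |>p _).
by rewrite -[RHS]mulg1 H mulKg.
Qed.

Lemma pact_conj l f m : l * (f |>p m) * l^-1 = (delta l * f) |>p m.
Proof. by rewrite pactA pact_delta. Qed.

Lemma delta_liftingE e f :
  e * f * e^-1 = delta (lifting e f) * (del e |>E f).
Proof. by rewrite delta_lifting actEV mulgVK. Qed.

Definition lift2 := sdprod pact_aut.
Definition edge := sdprod (actE_aut A).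

(* Conjugation of (f, l) = f̄ l by (g, e) = g e°; it encodes the lifting through
   {e, f} = ē f̄ ē^-1 e° f̄^-1 e°^-1. *)
Definition edge_act (x : edge) (y : lift2) : lift2 :=
  Sd pact_aut (sd1 x |>E (sd2 x * sd1 y * (sd2 x)^-1))
   (sd1 x |>L (lifting (sd2 x) (sd1 y)^-1 * (del (sd2 x) |>L sd2 y))).

(** The two product axioms of the lifting are exactly what is needed: [lifting_mull] gives
    compatibility with products of edges, and [liftingMr] gives multiplicativity in the element
    acted on. *)
Fact edge_act_aut : acts_by_automorphisms edge_act.
Proof.
split.
- move=> [f l]; rewrite /edge_act /= lifting1l mf1.
  by rewrite !actE1 !actL1 !gsimp.
- move=> [g e] [g' e'] [f l]; rewrite /edge_act /=.
  (* Writing e as a translate by g' cancels the g'^-1 that the product of edges introduces. *)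
  have [e1 ->] : exists e1, e = g' |>E e1.
    by exists (g'^-1 |>E e); rewrite actEVK.
  rewrite !actEK del_act !actEA -!actEV -!actEM; congr Sd.
    by rewrite !gnorm.
  rewrite -lifting_act -(actLA (g' * _ * _)) mulgVK (actLA g') -actLM -actLA.
  by rewrite lifting_mull mfM !actLM !actLA !gnorm.
- move=> [g e] [f l] [f' l']; rewrite /edge_act /= !sdM /=.
  rewrite -!actEV -!actEM -!act_pact -!actLM.
  congr Sd; first by rewrite !gnorm.
  congr (_ |>L _); rewrite invgM liftingMr actEV actLM act_pact actEV.
  have -> : (e * f' / e)^-1 = delta (lifting e f'^-1) * (del e |>E f')^-1.
    by rewrite -actEV -delta_liftingE !gnorm.
  by rewrite -pact_conj pactM !gnorm.
Qed.

Lemma lifting_deltaM e l f :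
  lifting e (delta l * f) = (e |>p l) * lifting e f * (del e |>L l)^-1.
Proof.
by rewrite liftingMr -delta_act pact_delta lifting_deltar !gnorm.
Qed.

(** The action of e f = δ{e,f} (∂e ▷ f) e, where δ{e,f} acts as conjugation by {e,f}. *)
Lemma pact_swap e f l :
  e |>p (f |>p l) =
  lifting e f * ((del e |>E f) |>p (e |>p l)) * (lifting e f)^-1.
Proof. by rewrite pact_conj -!pactA -delta_liftingE !gnorm. Qed.

(** A variant of [lifting_mull] without the conjugate f u f^-1: it is replaced by δ{f,u} (∂f ▷ u),
    and [lifting_deltaM] extracts {f,u}. *)
Lemma lifting_mull_pact e f u :
  lifting (e * f) u = (e |>p lifting f u) * lifting e (del f |>E u).
Proof. by rewrite lifting_mull delta_liftingE lifting_deltaM !gnorm. Qed.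

Lemma edge_actV g e f l :
  edge_act (Sd (actE_aut A) g e)^-1 (Sd pact_aut f l) =
  Sd pact_aut (e^-1 * (g^-1 |>E f) * e)
    (lifting e^-1 (g^-1 |>E f^-1) * (del e^-1 |>L g^-1 |>L l)).
Proof.
rewrite sdV /edge_act /= -!actEV !actEM !actEK actLM lifting_act actEK del_act.
by rewrite !actLA actLK !actEV invgK.
Qed.
End Xmod2.

(* [tri g u v l] = g u° v̄ κ(l): a triangle whose vertices are g, g ∂u, g ∂u ∂v. *)
Record triangles (A : xmod2) := Triangles {
  tgroup :> groupType;
  tri : grpG A -> grpE A -> grpE A -> grpL A -> tgroup;
  triM : forall g u v l g' u' v' l',
    tri g u v l * tri g' u' v' l' =
    tri (g * g') ((g'^-1 |>E u) * u') ((del u'^-1 |>E g'^-1 |>E v) * v')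
      ((v'^-1 |>p ((lifting u'^-1 (g'^-1 |>E v^-1))^-1 *
                   (u'^-1 |>p (g'^-1 |>L l)))) * l');
  tri_inj : forall g u v l g' u' v' l', tri g u v l = tri g' u' v' l' ->
    [/\ g = g', u = u', v = v' & l = l'];
  tri_surj : forall x, exists g u v l, x = tri g u v l
}.

(* Kept opaque: from here on the group is only accessed through [triM]. *)
Fact triangles_exist (A : xmod2) : triangles A.
Proof.
pose X : groupType := sdprod (edge_act_aut A).
(* Since κ(l) = (δ l)‾ l^-1, the product v̄ κ(l) is the pair (v δ(l), l^-1). *)
pose t g u v l : X :=
  Sd (edge_act_aut A) (Sd (actE_aut A) g u) (Sd (pact_aut A) (v * delta l) l^-1).
exists X t.
- move=> g u v l g' u' v' l'; rewrite /t sdM edge_actV sdM /= (actEV g'^-1 v).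
  set p := g'^-1 |>E v; set q := g'^-1 |>L l; congr Sd.
  have -> : g'^-1 |>E (v * delta l) = p * delta q by rewrite actEM /q delta_act.
  have -> : g'^-1 |>E (v * delta l)^-1 = delta q^-1 * p^-1.
    by rewrite actEV actEM invgM /q mfV delta_act.
  rewrite lifting_deltaM !actLV; congr Sd => /=.
    by rewrite !(mfM, mfV delta, delta_pact) delta_lifting !actEV !gnorm.
  by rewrite invgM pactA -mfV pact_delta !(pactM, pactV) !gnorm.
- move=> g u v l g' u' v' l' [-> -> vl /invg_inj ll].
  by move: vl; rewrite ll => /mulIg ->.
- move=> [[g u] [v l]]; exists g, u, (v * delta l), l^-1.
  by rewrite /t mfV invgK mulgK.
Qed.

Arguments tri {A} t.

(** * Tetrahedra and their products *)

Section Tetrahedra.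
Variables (A : xmod2) (X : triangles A).
Implicit Types (g h : grpG A) (e f u v w : grpE A) (l k m n : grpL A).

Local Notation t := (tri X).

Lemma del_mulV u v l : del (u * v * delta l)^-1 = del v^-1 * del u^-1.
Proof. by rewrite !(mfM, mfV) del_delta !gnorm. Qed.

(** This is the cocycle equation for face 013 of a product of tetrahedra, after the parts involving
    m, m', n' and the inverse of the last edge w' have been stripped off. Both sides are normalised
    by pulling every factor δ(_) out of the liftings and commuting actions with [pact_swap]. *)
Fact tet_lifting (U V p s : grpE A) ql qn l' :
  (V |>p ((lifting U (delta qn^-1 * s * p^-1))^-1 *
          (U |>p (qn^-1 * (s |>p ql))))) * l' =
  (V |>p (del U |>L qn)^-1) * lifting V (del U |>E s) *
  ((del (V * U) |>E s) |>p
     ((V |>p ((lifting U p^-1)^-1 * (U |>p ql))) * l')) *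
  ((lifting (delta l'^-1 * (V * U)) s)^-1 * l'^-1) * l'.
Proof.
set Y := (lifting U p^-1)^-1 * (U |>p ql).
have -> : (lifting (delta l'^-1 * (V * U)) s)^-1 * l'^-1 =
    ((del (V * U) |>E s) |>p l')^-1 * (lifting (V * U) s)^-1.
  rewrite lifting_mull lifting_deltal del_delta actL1 pactV invgK.
  by rewrite delta_liftingE -pact_conj !gnorm.
have -> : (lifting U (delta qn^-1 * s * p^-1))^-1 *
      (U |>p (qn^-1 * (s |>p ql))) =
    (del U |>L qn)^-1 * ((del U |>E s) |>p Y) * (lifting U s)^-1.
  rewrite -mulgA lifting_deltaM liftingMr actLV pactV !pactM pactV.
  by rewrite pact_swap pactV !gnorm.
clearbody Y; rewrite lifting_mull_pact mfM actEA !pactM pact_swap !pactV.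
by rewrite !gnorm.
Qed.

(* The faces are listed in the order 012, 023, 123, 013; the edges 01, 12, 23 are
   u, v, w. *)
Definition tet (a b c d : X) := exists g u v w l m n,
  [/\ a = t g u v l, b = t g (u * v * delta l) w m, c = t (g * del u) v w n
    & d = t g u (v * w * delta n) (n^-1 * (w^-1 |>p l) * m)].

Lemma tet_mul a b c d a' b' c' d' :
  tet a b c d -> tet a' b' c' d' -> tet (a * a') (b * b') (c * c') (d * d').
Proof.
move=> [g [u [v [w [l [m [n [-> -> -> ->]]]]]]]].
move=> [g' [u' [v' [w' [l' [m' [n' [-> -> -> ->]]]]]]]].
have gu : (g' * del u')^-1 = del u'^-1 * g'^-1 by rewrite invgM mfV.
have gg : g * del u * (g' * del u') = g * g' * del ((g'^-1 |>E u) * u').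
  by rewrite mfM del_act !gnorm.
rewrite !triM gu gg !actEA !actLA.
(* Faces 012 and 123 of the product fix all the data except m, which face 023 supplies. What remains
   is that the edges 02 and 13 match and that the label of face 013 is right. *)
do 7!eexists; split; [reflexivity | | reflexivity | ].
  rewrite del_mulV !actEA; congr tri; rewrite !(mfM, mfV delta, delta_pact).
  by rewrite delta_lifting !(actEM, actEV) delta_act !gnorm.
congr tri.
  rewrite !(mfM, mfV delta, delta_pact).
  by rewrite delta_lifting !(actEM, actEV) !delta_act !gnorm.
rewrite !(actEM g'^-1, actLM g'^-1, actEV g'^-1, actLV g'^-1, act_pact, invgM).
set p := g'^-1 |>E v; set r := g'^-1 |>E w.
set ql := g'^-1 |>L l; set qm := g'^-1 |>L m; set qn := g'^-1 |>L n.
have -> : g'^-1 |>E delta n = delta qn by rewrite /qn delta_act.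
clearbody p r ql qm qn; rewrite -!(mfV delta).
set U := u'^-1; set V := v'^-1; set W := w'^-1.
rewrite -!actEV; set s := r^-1; clearbody s.
have main := tet_lifting U V p s ql qn l'.
set K := (l'^-1 * ((V * U) |>p qm) * l').
transitivity (n'^-1 * (W |>p ((V |>p ((lifting U (delta qn^-1 * s * p^-1))^-1 *
          (U |>p (qn^-1 * (s |>p ql))))) * l' * K)) * m').
  by rewrite /K pactA pact_delta !pactA !pactM !pactV !gnorm.
rewrite main {}/K (pactA (delta _)) pact_delta mfM actEA.
by rewrite !pactM !pactA !pactV !gnorm.
Qed.

Lemma tri1 : t 1 1 1 1 = 1.
Proof.
apply: mulg_idem.
by rewrite triM !(mf1, invg1, actE1, actL1, lifting1l, pact1, mulg1).
Qed.

(** The cocycle equation can be solved for the label of any one face, and matching edges do the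
    rest; this and the next two lemmas cover the faces 013, 023 and 123. *)
Lemma tet_uniq013 a b c d d' : tet a b c d -> tet a b c d' -> d = d'.
Proof.
move=> [g [u [v [w [l [m [n [-> -> -> ->]]]]]]]].
move=> [g' [u' [v' [w' [l' [m' [n' [/tri_inj[-> -> -> ->] + + ->]]]]]]]].
by move=> /tri_inj[_ _ -> ->] /tri_inj[_ _ _ ->].
Qed.

Lemma tet_uniq023 a b b' c d : tet a b c d -> tet a b' c d -> b = b'.
Proof.
move=> [g [u [v [w [l [m [n [-> -> -> ->]]]]]]]].
move=> [g' [u' [v' [w' [l' [m' [n' [/tri_inj[-> -> -> ->] -> + +]]]]]]]].
by move=> /tri_inj[_ _ -> ->] /tri_inj[_ _ _ /mulgI ->].
Qed.

Lemma tet_uniq123 a b c c' d : tet a b c d -> tet a b c' d -> c = c'.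
Proof.
move=> [g [u [v [w [l [m [n [-> -> -> ->]]]]]]]].
move=> [g' [u' [v' [w' [l' [m' [n' [/tri_inj[-> -> -> ->] + -> +]]]]]]]].
by move=> /tri_inj[_ _ -> ->] /tri_inj[_ _ _ /mulIg/mulIg/invg_inj ->].
Qed.
End Tetrahedra.

(** * Quadratic derivations as homomorphisms *)

Section Homotopies.
Variables (C D : xmod2) (X : triangles D).
Implicit Types (f : xmod2_map C D) (s : grpG C -> grpE D) (t : grpE C -> grpL D).
Implicit Types (phi : {multiplicative grpG C -> grpG D}).

Local Notation tri := (tri X).
Definition gsimpD := (mf1 (@del D), actE1, actL1, actEg1, actLg1,
  @lifting1l D, @lifting1r D, @pact1 D, @pactg1 D, gsimp).

Lemma derivation1 phi s : is_derivation phi s -> s 1 = 1.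
Proof. by move=> sM; apply: mulg_idem; rewrite -{1}(mulg1 1) sM mf1 !gsimpD. Qed.

Lemma derivationV phi s g : is_derivation phi s -> s g^-1 = phi g |>E (s g)^-1.
Proof.
move=> sM; apply: (@mulgI _ (phi g |>E s g)).
by rewrite -actEM mulgV actEg1 -(derivation1 sM) -(mulgV g) sM mfV invgK.
Qed.

(** Conjugates occur because ∂(g ▷ a) = g ∂(a) g^-1. *)
Lemma derivationJ phi s g h : is_derivation phi s ->
  s (g * h * g^-1) = phi g |>E (((phi h)^-1 |>E s g) * s h * (s g)^-1).
Proof.
by move=> sM; rewrite sM (derivationV _ sM) sM mfV invgK -actEM.
Qed.

Lemma derivationP phi s :
  is_derivation phi s <-> {morph (fun g => tri (phi g) (s g) 1 1) : x y / x * y}.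
Proof.
split=> sM x y.
  by rewrite triM sM mfM !gsimpD.
by have := sM x y; rewrite triM => /tri_inj[_ ->].
Qed.

Lemma tri_barM phi s : is_derivation phi s ->
  {morph (fun g => tri (phi g) 1 (s g) 1) : x y / x * y}.
Proof. by move=> sM x y; rewrite triM sM mfM !gsimpD. Qed.

Definition quad_mul f s t := forall a b,
  t (a * b) = ((s (del b))^-1 |>p
     ((lifting (mapE f b)^-1 (s (del a))^-1)^-1 * ((mapE f b)^-1 |>p t a))) * t b.

Definition htri f s t a := tri 1 (mapE f a) (s (del a)) (t a).

Lemma quad_mulP f s t : is_derivation (mapG f) s ->
  quad_mul f s t <-> {morph (htri f s t) : a b / a * b}.
Proof.
move=> sM; split=> tM a b; last first.
  by have := tM a b; rewrite triM => /tri_inj[_ _ _ ->]; rewrite !gsimpD.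
by rewrite /htri triM tM !mfM sM -map_del !mfV !gsimpD.
Qed.

(** The long edge of the triangle [htri f s t a]. *)
Definition tgtE f s t a := mapE f a * s (del a) * delta (t a).

(** The equivariance rule for t rewritten around the long edge: [lifting_deltaM] absorbs the action
    of ∂(s g) on t(a) into a lifting with [tgtE], which separates the contribution of [htri] from
    that of its long edge. *)
Definition quad_act f s t := forall g a,
  t (g |>E a) =
    mapG f g |>L
      (((s g * (s (del a))^-1) |>p (lifting (mapE f a)^-1 (s g)^-1)^-1) *
       (s g |>p t a) * lifting (s g) (tgtE f s t a)^-1).

Lemma quadratic_derivationE f s t :
  is_quadratic_derivation f s t <->
  [/\ is_derivation (mapG f) s, quad_mul f s t & quad_act f s t].
Proof.
suff E g a : mapG f g |>L
      (((s g * (s (del a))^-1) |>p (lifting (mapE f a)^-1 (s g)^-1)^-1) *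
       (s g |>p t a) * lifting (s g) (tgtE f s t a)^-1) =
   (mapG f g |>L
             ((s g * (s (del a))^-1) |>p (lifting (mapE f a)^-1 (s g)^-1)^-1))
          * (mapG f g |>L lifting (s g) ((s (del a))^-1 * (mapE f a)^-1))
          * ((mapG f g * del (s g)) |>L t a).
  rewrite /quad_mul /quad_act; split=> -[sM tM tA]; split=> // a b.
  - by rewrite tM pact.unlock.
  - by rewrite E tA pact.unlock.
  - by rewrite tM pact.unlock.
  - by rewrite tA E pact.unlock.
rewrite actLA -!actLM; congr (_ |>L _); rewrite /tgtE !invgM -(mfV delta).
by rewrite lifting_deltaM actLV !pactV !gnorm.
Qed.

Lemma lifting_Vl (e u : grpE D) :
  e |>p lifting e^-1 (del e |>E u) = (lifting e u)^-1.
Proof.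
apply: (@mulIg _ (lifting e u)); rewrite mulVg.
have := lifting_mull_pact e e^-1 (del e |>E u).
by rewrite mulgV lifting1l -actEA -mfM mulVg mf1 actE1.
Qed.

(** Applying δ to [quad_act] yields liftings whose images compensate the failure of ψ(a) s(∂a) to be
    equivariant. *)
Lemma tgtE_act f s t g a : is_derivation (mapG f) s -> quad_act f s t ->
  tgtE f s t (g |>E a) = (mapG f g * del (s g)) |>E tgtE f s t a.
Proof.
move=> sM tA; rewrite {1}/tgtE tA map_actE del_act (derivationJ _ _ sM).
rewrite delta_act -!actEM actEA; congr (_ |>E _).
rewrite -map_del -(mfV del) -(mfV (mapE f)).
rewrite !(mfM delta, mfV delta, delta_pact) !delta_lifting.
have -> : delta (t a) = (mapE f a * s (del a))^-1 * tgtE f s t a.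
  by rewrite /tgtE !gnorm.
by rewrite !(mfV (mapE f)) !actEV !gnorm.
Qed.

(** The label found here consists of the first two factors of [quad_act]; the remaining lifting is
    the label in [circ_bar]. *)
Lemma bar_htri f s t g a l : is_derivation (mapG f) s ->
  tri (mapG f g) 1 (s g) 1 * htri f s t a =
    tri 1 (mapE f (g |>E a)) (s (del (g |>E a))) l * tri (mapG f g) 1 (s g) 1
  <-> l = mapG f g |>L
    (((s g * (s (del a))^-1) |>p (lifting (mapE f a)^-1 (s g)^-1)^-1) *
     (s g |>p t a)).
Proof.
move=> sM; rewrite !triM map_actE !gsimpD actEK.
rewrite del_act (derivationJ _ _ sM) actEK -map_del -(mfV del) mulgVK.
split=> [/tri_inj[_ _ _ E]|->].
  by rewrite pactA -pactM E pactVK actLVK.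
by rewrite actLK pactA -pactM pactK.
Qed.

(** Conjugating ū by g e° leaves a label m, and this label is how the lifting enters the group of
    triangles. *)
Lemma circ_bar g e u u' m :
  tri g e 1 1 * tri 1 1 u 1 = tri 1 1 u' m * tri g e 1 1
  <-> u' = (g * del e) |>E u /\ m = g |>L (lifting e u^-1)^-1.
Proof.
have gK y : g^-1 |>E ((g * del e) |>E y) = del e |>E y.
  by rewrite actEA actEK.
rewrite !triM !gsimpD; split=> [/tri_inj[_ _ uE mE]|[-> ->]]; last first.
  by rewrite -actEV !gK mfV actEK -(lifting_Vl e) actLK pactK mulVg.
have {uE}uE : u' = (g * del e) |>E u by rewrite uE mfV actEA !actEVK.
split=> //; move: mE; rewrite uE -actEV gK => mE.
rewrite -(lifting_Vl e) -[LHS](actLVK g) -[g^-1 |>L m](pactVK e).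
congr (_ |>L (_ |>p _)).
by rewrite -[LHS](mulKg (lifting e^-1 (del e |>E u^-1))^-1) -mE invgK mulg1.
Qed.

(* A homotopy sends a to a square cut into the triangles [htri a] and ψ'(a)‾.  The
   square is equivariant, but its two halves are so only up to a common m. *)
Lemma quad_actP f s t : is_derivation (mapG f) s ->
  quad_act f s t <-> forall g a, exists m,
    [/\ tri (mapG f g) 1 (s g) 1 * htri f s t a =
      tri 1 (mapE f (g |>E a)) (s (del (g |>E a))) (t (g |>E a) * m) *
      tri (mapG f g) 1 (s g) 1
    & tri (mapG f g) (s g) 1 1 * tri 1 1 (tgtE f s t a) 1 =
      tri 1 1 (tgtE f s t (g |>E a)) m * tri (mapG f g) (s g) 1 1].
Proof.
move=> sM; split=> tA g a.
  exists (mapG f g |>L (lifting (s g) (tgtE f s t a)^-1)^-1); split.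
    by apply/(bar_htri _ _ _ _ sM); rewrite tA -actLM !gnorm.
  by apply/circ_bar; rewrite (tgtE_act _ _ sM tA).
have [m [/(bar_htri _ _ _ _ sM) tE /circ_bar[_ mE]]] := tA g a.
by rewrite actLM -tE mE actLV mulgVK.
Qed.
End Homotopies.

(** * Composites *)

(* Z fills the triangle s1, s2, s3; two of the pairs (s1, t1), (s2, t2), (s3, t3)
   being quadratic derivations makes the third one so.  For concatenations and
   inverses w is ω; for a 2-fold homotopy s1 = 1 and w = k. *)
Section Composite.
Variables (C D : xmod2) (X : triangles D) (f f1 : xmod2_map C D).
Variables (s1 s2 s3 : grpG C -> grpE D) (t1 t2 t3 : grpE C -> grpL D).
Variable w : grpG C -> grpL D.

Local Notation tri := (tri X).
Local Notation phi := (mapG f).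
Local Notation Z := (fun x => tri (phi x) (s1 x) (s2 x) (w x)^-1).

Hypothesis s1M : is_derivation phi s1.
Hypothesis f1G : forall g, mapG f1 g = phi g * del (s1 g).
Hypothesis f1E : forall a, mapE f1 a = tgtE f s1 t1 a.
Hypothesis ZM : {morph Z : x y / x * y}.
Hypothesis s3E : forall x, s3 x = s1 x * s2 x * (delta (w x))^-1.
Hypothesis t3E :
  forall a, t3 a = w (del a) * ((s2 (del a))^-1 |>p t1 a) * t2 a.

Lemma comp_s2M : is_derivation (mapG f1) s2.
Proof.
move=> x y; have := ZM x y; rewrite triM => /tri_inj[_ _ -> _].
by rewrite f1G invgM -(mfV del) actEA.
Qed.

Lemma comp_s3M : is_derivation phi s3.
Proof.
move=> x y; rewrite !s3E -!(mfV delta).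
have := ZM x y; rewrite triM => /tri_inj[_ -> -> ->].
rewrite !(mfM, mfV delta, delta_pact) delta_lifting !(actEM, actEV) delta_act.
by rewrite !(mfV delta) !actEV !gnorm.
Qed.

Definition dsimp := (mf1 (@delta D), invg1, gsimpD).

(** The hypothesis [t3E] is the cocycle equation of a tetrahedron with edges ψ(a), s1(∂a), s2(∂a),
    whose face 123 is Z(∂a). *)
Lemma comp_tet a :
  tet (htri X f s1 t1 a) (htri X f1 s2 t2 a) (Z (del a)) (htri X f s3 t3 a).
Proof.
exists 1, (mapE f a), (s1 (del a)), (s2 (del a)), (t1 a), (t2 a).
exists (w (del a))^-1.
by split; rewrite /htri ?f1E ?t3E ?s3E ?map_del ?(mfV delta) ?gsimp.
Qed.

Lemma comp_quad_mul3 :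
  quad_mul f s1 t1 -> quad_mul f1 s2 t2 -> quad_mul f s3 t3.
Proof.
move=> /(quad_mulP X _ s1M) M1 /(quad_mulP X _ comp_s2M) M2.
apply/(quad_mulP X _ comp_s3M) => a b.
apply: tet_uniq013 (comp_tet (a * b)) _.
by rewrite M1 M2 mfM ZM; apply: tet_mul; apply: comp_tet.
Qed.

Lemma comp_quad_mul2 :
  quad_mul f s1 t1 -> quad_mul f s3 t3 -> quad_mul f1 s2 t2.
Proof.
move=> /(quad_mulP X _ s1M) M1 /(quad_mulP X _ comp_s3M) M3.
apply/(quad_mulP X _ comp_s2M) => a b.
apply: tet_uniq023 (comp_tet (a * b)) _.
by rewrite M1 M3 mfM ZM; apply: tet_mul; apply: comp_tet.
Qed.

Lemma comp_tgtE a : tgtE f s3 t3 a = tgtE f1 s2 t2 a.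
Proof.
by rewrite /tgtE f1E /tgtE s3E t3E !(mfM delta, delta_pact) !gnorm.
Qed.

Lemma comp_tgtG g : phi g * del (s3 g) = mapG f1 g * del (s2 g).
Proof. by rewrite f1G s3E !mfM mfV del_delta !gnorm. Qed.

(* The three tetrahedra of the prism over the triangle s1, s2, s3, conjugated by
   their values at g, transport the correcting terms m1, m2, m3. *)
Section Conj.
Variables (g : grpG C) (a : grpE C) (m1 m2 m3 : grpL D).
Local Notation a' := (g |>E a).
Local Notation bar3 := (tri 1 1 (tgtE f s3 t3 a) 1).
Hypothesis H1 : tri (phi g) 1 (s1 g) 1 * htri X f s1 t1 a =
  tri 1 (mapE f a') (s1 (del a')) (t1 a' * m1) * tri (phi g) 1 (s1 g) 1.
Hypothesis K1 : tri (phi g) (s1 g) 1 1 * tri 1 1 (mapE f1 a) 1 =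
  tri 1 1 (mapE f1 a') m1 * tri (phi g) (s1 g) 1 1.
Hypothesis K2 : tri (mapG f1 g) (s2 g) 1 1 * bar3 =
  tri 1 1 (tgtE f s3 t3 a') m2 * tri (mapG f1 g) (s2 g) 1 1.
Hypothesis K3 : tri (phi g) (s3 g) 1 1 * bar3 =
  tri 1 1 (tgtE f s3 t3 a') m3 * tri (phi g) (s3 g) 1 1.

(** The third tetrahedron of the prism, degenerate because its edges 01 and 12 are trivial. *)
Lemma comp_tet_III_a a0 :
  let b := tri 1 1 (tgtE f s3 t3 a0) 1 in tet 1 b b b.
Proof.
exists 1, 1, 1, (tgtE f s3 t3 a0), 1, 1, 1.
by rewrite -(tri1 X) !dsimp.
Qed.

(** Multiply the degenerate tetrahedron on the left by one with faces 012 and 013 equal to [Z g].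
    Then [K2] and [K3] rewrite two faces of the product, which forces its face 013. *)
Lemma comp_bar3 : Z g * bar3 =
  tri 1 1 (tgtE f s3 t3 a' * delta m2) (m2^-1 * m3) * Z g.
Proof.
have G3 : tet (Z g) (tri (phi g) (s3 g) 1 1) (tri (mapG f1 g) (s2 g) 1 1) (Z g).
  exists (phi g), (s1 g), (s2 g), 1, (w g)^-1, 1, 1.
  by rewrite f1G s3E (mfV delta) !dsimp.
have A3 := tet_mul G3 (comp_tet_III_a a).
rewrite mulg1 K2 K3 in A3; apply: (tet_uniq013 A3).
suff A : tet 1 (tri 1 1 (tgtE f s3 t3 a') m3) (tri 1 1 (tgtE f s3 t3 a') m2)
    (tri 1 1 (tgtE f s3 t3 a' * delta m2) (m2^-1 * m3)).
  by have := tet_mul A G3; rewrite mul1g.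
exists 1, 1, 1, (tgtE f s3 t3 a'), 1, m3, m2.
by rewrite -(tri1 X) !dsimp.
Qed.

(** The label of the face common to the other two conjugated tetrahedra. It solves the cocycle
    equation in [A2'], where faces 012, 123 and 013 are labelled m1, t2(a') m2 and m2^-1 m3. *)
Let q := (((s2 (del a'))^-1 |>p m1)^-1 * t2 a' * m3).
Local Notation b2 := (tri 1 (mapE f1 a' * delta m1) (s2 (del a')) q).

Let G2 : tet (tri (phi g) (s1 g) 1 1) (Z g) (tri (mapG f1 g) 1 (s2 g) 1) (Z g).
Proof.
exists (phi g), (s1 g), 1, (s2 g), 1, (w g)^-1, 1.
by rewrite f1G !dsimp.
Qed.

Let A2 : tet (tri 1 1 (mapE f1 a') m1 * tri (phi g) (s1 g) 1 1)
  (Z g * htri X f1 s2 t2 a) (tri (mapG f1 g) 1 (s2 g) 1 * htri X f1 s2 t2 a)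
  (tri 1 1 (tgtE f s3 t3 a' * delta m2) (m2^-1 * m3) * Z g).
Proof.
rewrite -K1 -comp_bar3; apply: (tet_mul G2).
exists 1, 1, (mapE f1 a), (s2 (del a)), 1, (t2 a), (t2 a).
by rewrite comp_tgtE /tgtE !dsimp.
Qed.

Let A2' : tet (tri 1 1 (mapE f1 a') m1 * tri (phi g) (s1 g) 1 1)
  (b2 * Z g)
  (tri 1 (mapE f1 a') (s2 (del a')) (t2 a' * m2) * tri (mapG f1 g) 1 (s2 g) 1)
  (tri 1 1 (tgtE f s3 t3 a' * delta m2) (m2^-1 * m3) * Z g).
Proof.
apply: tet_mul G2.
exists 1, 1, (mapE f1 a'), (s2 (del a')), m1, q, (t2 a' * m2).
by rewrite comp_tgtE /tgtE /q (mfM delta) !dsimp !gnorm.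
Qed.

Let G1 : tet (tri (phi g) 1 (s1 g) 1) (Z g) (Z g) (tri (phi g) 1 (s3 g) 1).
Proof.
exists (phi g), 1, (s1 g), (s2 g), 1, (w g)^-1, (w g)^-1.
by rewrite s3E (mfV delta) !dsimp.
Qed.

Let A1 : tet
  (tri 1 (mapE f a') (s1 (del a')) (t1 a' * m1) * tri (phi g) 1 (s1 g) 1)
  (Z g * htri X f1 s2 t2 a) (Z (del a') * Z g)
  (tri (phi g) 1 (s3 g) 1 * htri X f s3 t3 a).
Proof.
rewrite -H1; have -> : Z (del a') * Z g = Z g * Z (del a).
  by rewrite -!ZM del_act mulgVK.
exact: tet_mul G1 (comp_tet a).
Qed.

Let A1' : tet
  (tri 1 (mapE f a') (s1 (del a')) (t1 a' * m1) * tri (phi g) 1 (s1 g) 1)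
  (b2 * Z g) (Z (del a') * Z g)
  (tri 1 (mapE f a') (s3 (del a')) (t3 a' * m3) * tri (phi g) 1 (s3 g) 1).
Proof.
apply: tet_mul G1.
exists 1, (mapE f a'), (s1 (del a')), (s2 (del a')), (t1 a' * m1), q.
exists (w (del a'))^-1.
rewrite f1E /tgtE s3E t3E /q -map_del (mfM delta) (mfV delta) pactM.
by rewrite !dsimp !gnorm.
Qed.

(** Once [H2] is substituted, [A2] and [A2'] agree on three faces, so their shared face
    [Z g * htri X f1 s2 t2 a] equals [b2 * Z g]. This makes [A1] and [A1'] agree on three faces in
    turn. The next lemma goes the other way, from [A1] to [A2]. *)
Lemma comp_conj3 :
  tri (mapG f1 g) 1 (s2 g) 1 * htri X f1 s2 t2 a =
  tri 1 (mapE f1 a') (s2 (del a')) (t2 a' * m2) * tri (mapG f1 g) 1 (s2 g) 1 ->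
  tri (phi g) 1 (s3 g) 1 * htri X f s3 t3 a =
  tri 1 (mapE f a') (s3 (del a')) (t3 a' * m3) * tri (phi g) 1 (s3 g) 1.
Proof.
move=> H2; apply: tet_uniq013 A1'.
have := A2; rewrite H2 => A.
by rewrite -(tet_uniq023 A A2'); exact: A1.
Qed.

Lemma comp_conj2 :
  tri (phi g) 1 (s3 g) 1 * htri X f s3 t3 a =
  tri 1 (mapE f a') (s3 (del a')) (t3 a' * m3) * tri (phi g) 1 (s3 g) 1 ->
  tri (mapG f1 g) 1 (s2 g) 1 * htri X f1 s2 t2 a =
  tri 1 (mapE f1 a') (s2 (del a')) (t2 a' * m2) * tri (mapG f1 g) 1 (s2 g) 1.
Proof.
move=> H3; apply: tet_uniq123 A2'.
have := A1; rewrite H3 => A.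
by rewrite -(tet_uniq023 A A1'); exact: A2.
Qed.
End Conj.

Lemma comp_quad_act3 :
  quad_act f s1 t1 -> quad_act f1 s2 t2 -> quad_act f s3 t3.
Proof.
move=> tA1 tA2; apply/(quad_actP X _ comp_s3M) => g a.
have [m1 [H1 K1]] := (quad_actP X _ s1M).1 tA1 g a; rewrite -!f1E in K1.
have [m2 [H2 K2]] := (quad_actP X _ comp_s2M).1 tA2 g a.
rewrite -!comp_tgtE in K2.
(* The pairs (s2, t2) and (s3, t3) have the same long edge, so its equivariance is already known and
   [circ_bar] produces m3. *)
have [m3 K3] : exists m, tri (phi g) (s3 g) 1 1 * tri 1 1 (tgtE f s3 t3 a) 1 =
  tri 1 1 (tgtE f s3 t3 (g |>E a)) m * tri (phi g) (s3 g) 1 1.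
  eexists; apply/circ_bar; split; last reflexivity.
  by rewrite comp_tgtG !comp_tgtE (tgtE_act _ _ comp_s2M).
by exists m3; split; first exact: comp_conj3 H1 K1 K2 K3 H2.
Qed.

Lemma comp_quad_act2 :
  quad_act f s1 t1 -> quad_act f s3 t3 -> quad_act f1 s2 t2.
Proof.
move=> tA1 tA3; apply/(quad_actP X _ comp_s2M) => g a.
have [m1 [H1 K1]] := (quad_actP X _ s1M).1 tA1 g a; rewrite -!f1E in K1.
have [m3 [H3 K3]] := (quad_actP X _ comp_s3M).1 tA3 g a.
have [m2 K2] : exists m,
  tri (mapG f1 g) (s2 g) 1 1 * tri 1 1 (tgtE f s3 t3 a) 1 =
  tri 1 1 (tgtE f s3 t3 (g |>E a)) m * tri (mapG f1 g) (s2 g) 1 1.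
  eexists; apply/circ_bar; split; last reflexivity.
  by rewrite -comp_tgtG (tgtE_act _ _ comp_s3M).
exists m2; split; first exact: comp_conj2 H1 K1 K2 K3 H3.
by rewrite -!comp_tgtE.
Qed.

Lemma comp_quad3 : is_quadratic_derivation f s1 t1 ->
  is_quadratic_derivation f1 s2 t2 -> is_quadratic_derivation f s3 t3.
Proof.
move=> /quadratic_derivationE[_ M1 A1] /quadratic_derivationE[_ M2 A2].
apply/quadratic_derivationE; split; first exact: comp_s3M.
  exact: comp_quad_mul3.
exact: comp_quad_act3.
Qed.

Lemma comp_quad2 : is_quadratic_derivation f s1 t1 ->
  is_quadratic_derivation f s3 t3 -> is_quadratic_derivation f1 s2 t2.
Proof.
move=> /quadratic_derivationE[_ M1 A1] /quadratic_derivationE[_ M3 A3].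
apply/quadratic_derivationE; split; first exact: comp_s2M.
  exact: comp_quad_mul2.
exact: comp_quad_act2.
Qed.
End Composite.

(** * The target of a homotopy *)

Section TargetLifting.
Variable D : xmod2.
Implicit Types (a b e u : grpE D) (l r : grpL D).

Lemma pact_act_del e l :
  e |>p (del e^-1 |>L l) = lifting e (del e^-1 |>E delta l) * l.
Proof.
by rewrite -delta_act lifting_deltar -actLA -mfM mulgV mf1 actL1 mulgVK.
Qed.

Lemma lifting_pactV e u :
  (e^-1 |>p lifting e u^-1) = ((u^-1 * e^-1) |>p lifting e u)^-1.
Proof.
rewrite liftingVr pactV -pactA; congr (_^-1).
have -> : u^-1 * e^-1 = e^-1 * (e * u * e^-1)^-1 by rewrite !gnorm.
by rewrite delta_liftingE invgM -mfV !pactA pact_delta invgK mulVg mul1g.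
Qed.

Variables (a b S R : grpE D) (l r : grpL D).
Let a' := a * S * delta l.
Let b' := b * R * delta r.
Let Q := del b^-1 |>E S.
Let Sc := Q * R * S^-1.
Let z := b^-1 * (del S |>E b').
Let Y := ((S * R^-1) |>p (lifting b^-1 S^-1)^-1) * (S |>p r) * lifting S b'^-1.

(** Up to the action of ∂a, this is the equivariance of the target map on E: b Sc δ(Y) = ∂S ▷ b'. *)
Let ScY : Sc * delta Y = z.
Proof.
rewrite /Sc /Y !(mfM delta) !delta_pact (mfV delta) !delta_lifting /z /Q /b' !actEV.
by rewrite !gnorm.
Qed.

Let lca_eq : (lifting a^-1 (del a |>E Sc)^-1)^-1 * (a^-1 |>p (del a |>L Y)) =
  (Sc^-1 |>p (a^-1 |>p (lifting a z)^-1)) * Y.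
Proof.
have -> : del a |>L Y = del a^-1^-1 |>L Y by rewrite invgK.
rewrite pact_act_del invgK -[delta Y](mulKg Sc) ScY actEM.
rewrite liftingMr actEV -actEV -actEA -mfM mulVg mf1 actE1.
by rewrite -(lifting_Vl a) pactK !gnorm.
Qed.

(* The two sides evaluate t(ab) and t({a,b} (∂a |> b) a), where l = t(a),
   r = t(b), S = s(∂a), R = s(∂b), ∂a |> Sc = s(∂(∂a |> b)) and ∂a |> Y =
   t(∂a |> b); it is solved for the value t(δ{a,b}) = {a,b}^-1 {a',b'}. *)
Lemma target_lifting_identity :
  (R^-1 |>p ((lifting b^-1 S^-1)^-1 * (b^-1 |>p l))) * r =
  ((S^-1 * Sc^-1) |>p (a^-1 |>p ((del a |>E b)^-1 |>p
     ((lifting a b)^-1 * lifting a' b')))) *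
  ((S^-1 |>p ((lifting a^-1 (del a |>E Sc)^-1)^-1 *
     (a^-1 |>p (del a |>L Y)))) * l).
Proof.
(* W is {S δ(l), b'}, the contribution of the factor S δ(l) of a' to {a', b'}. *)
set W := (S |>p (l * (b' |>p l^-1))) * lifting S b'.
have EW : (del a |>E b)^-1 |>p ((lifting a b)^-1 * lifting a' b') =
    (a * b^-1) |>p W * lifting a z.
  have -> : lifting a' b' = (a |>p W) * lifting a (del S |>E b').
    rewrite /a' lifting_mull_pact del_delta actE1 lifting_deltal lifting_mull_pact.
    by rewrite /W !pactM !pactV !pactA !gnorm.
  have -> : lifting a (del S |>E b') = lifting a b * ((del a |>E b) |>p lifting a z).
    by rewrite -liftingMr /z mulVKg.
  have -> : (del a |>E b)^-1 = (a * b * a^-1)^-1 * delta (lifting a b).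
    by rewrite delta_liftingE invgM mulgVK.
  rewrite (pactA _ (delta _)) pact_delta !mulgA mulgV mul1g.
  rewrite -!(mulgA (a |>p W)) -2!mulgA.
  rewrite (mulgA a b) (mulgA (lifting a b)) pact_conj -delta_liftingE pactM.
  rewrite pactK -pactA.
  by rewrite !gnorm.
transitivity (((S^-1 * Sc^-1 * b^-1) |>p W) * (S^-1 |>p Y) * l); last first.
  rewrite EW lca_eq; clearbody W Y.
  by rewrite !(pactM, pactA, pactV) pactK !gnorm.
have -> : S^-1 * Sc^-1 * b^-1 = R^-1 * (Q^-1 * b^-1).
  by rewrite /Sc !gnorm.
(* Commuting b^-1 past S costs a lifting, whose δ then acts by conjugation; this is the lifting in
   the product rule for t(ab). *)
have QJ : Q^-1 * b^-1 * S = delta (lifting b^-1 S^-1)^-1 * b^-1.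
  by rewrite (mfV delta) delta_lifting !invgK -/Q !gnorm.
have -> : W = S |>p (l * (b' |>p l^-1) * (S^-1 |>p lifting S b')).
  by rewrite pactM pactVK.
set T := l * _ * _.
have -> : (R^-1 * (Q^-1 * b^-1)) |>p (S |>p T) =
    R^-1 |>p ((lifting b^-1 S^-1)^-1 * (b^-1 |>p T) * lifting b^-1 S^-1).
  by rewrite -pactA -mulgA QJ !pactA pact_delta invgK.
have -> : S^-1 |>p Y = (R^-1 |>p (lifting b^-1 S^-1)^-1) * r *
    (b'^-1 |>p (S^-1 |>p lifting S b'))^-1.
  by rewrite /Y !pactM lifting_pactV pactA !pactK -pactA.
rewrite /T; move: (S^-1 |>p _) (lifting _ _) => K J.
have -> : b'^-1 |>p K = r^-1 * ((R^-1 * b^-1) |>p K) * r.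
  by rewrite /b' invgM -(mfV delta) pactA pact_delta invgK invgM.
have -> : b' |>p l^-1 = b |>p (R |>p (r * l^-1 * r^-1)).
  by rewrite /b' 2!pactA pact_delta.
by rewrite !(pactM, pactV, pactA) !pactK !gnorm.
Qed.
End TargetLifting.

Definition mk_mult (G H : groupType) (f : G -> H)
    (fM : {morph f : x y / x * y}) : {multiplicative G -> H} :=
  HB.pack f (isMultiplicative.Build G H f fM).

Lemma pact_inj (D : xmod2) (e : grpE D) : injective (pact e).
Proof. exact: can_inj (pactK e). Qed.

Section Target.
Variables (C D : xmod2) (f : xmod2_map C D).
Variables (s : grpG C -> grpE D) (t : grpE C -> grpL D).
Hypothesis st : is_quadratic_derivation f s t.

Let sM : is_derivation (mapG f) s.
Proof. by have /quadratic_derivationE[] := st. Qed.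
Let tM : quad_mul f s t.
Proof. by have /quadratic_derivationE[] := st. Qed.
Let tA : quad_act f s t.
Proof. by have /quadratic_derivationE[] := st. Qed.

Definition tgtL l := mapL f l * t (delta l).
Definition tgtG g := mapG f g * del (s g).

Fact tgtG_M : {morph tgtG : x y / x * y}.
Proof.
by move=> x y; rewrite /tgtG sM !mfM del_act !gnorm.
Qed.

Fact tgtE_M : {morph tgtE f s t : a b / a * b}.
Proof.
move=> a b; rewrite /tgtE tM !mfM sM !(mfM delta, delta_pact).
rewrite (mfV delta) delta_lifting -map_del mfV !actEV.
by rewrite !gnorm.
Qed.

(** On the image of δ, s is evaluated at ∂δ = 1, so the product rule only conjugates t(δ l) by
    μ(k). *)
Fact tgtL_M : {morph tgtL : l k / l * k}.
Proof.
move=> l k; rewrite /tgtL !(mfM delta) tM !(mfM (mapL f)) !del_delta.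
rewrite (derivation1 sM) -map_delta invg1 lifting1r pact1 invg1 mul1g.
by rewrite -mfV pact_delta !gnorm.
Qed.

Fact tgt_delta l : delta (tgtL l) = tgtE f s t (delta l).
Proof.
by rewrite /tgtL /tgtE mfM map_delta del_delta (derivation1 sM) mulg1.
Qed.

Fact tgt_del a : del (tgtE f s t a) = tgtG (del a).
Proof. by rewrite /tgtG /tgtE !mfM del_delta map_del mulg1. Qed.

Fact tgt_actL g l : tgtL (g |>L l) = tgtG g |>L tgtL l.
Proof.
rewrite {1}/tgtL delta_act map_actL tA -tgt_delta -actLM actLA.
congr (_ |>L _).
rewrite del_delta (derivation1 sM) -map_delta -(mfV delta) lifting_deltal.
rewrite -(mfV delta) lifting_deltar actLV {1}/tgtL invg1 mulg1.
by rewrite !(invgM, pactM, pactV) pactVK !gnorm.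
Qed.

(** The product rule for t is applied to both sides of a b = δ{a,b} (∂a ▷ b) a. Comparison with
    [target_lifting_identity] and cancellation leave the value of t(δ{a,b}). *)
Fact tgt_lifting a b :
  tgtL (lifting a b) = lifting (tgtE f s t a) (tgtE f s t b).
Proof.
have := target_lifting_identity (mapE f a) (mapE f b)
  (s (del a)) (s (del b)) (t a) (t b).
rewrite -tM -/(tgtE f s t a) -/(tgtE f s t b).
set c := del a |>E b.
have <- : mapE f c = del (mapE f a) |>E mapE f b by rewrite map_actE map_del.
set Sc := _ / s (del a); have ScE : del (mapE f a) |>E Sc = s (del c).
  by rewrite map_del del_act (derivationJ _ _ sM) /Sc mfV map_del.
clearbody Sc; rewrite ScE; have <- : t c = del (mapE f a) |>L
    ((s (del a) / s (del b)) |>p (lifting (mapE f b)^-1 (s (del a))^-1)^-1 *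
     s (del a) |>p t b * lifting (s (del a)) (tgtE f s t b)^-1).
  by rewrite tA map_del.
rewrite -tM; have -> : a * b = delta (lifting a b) * (c * a).
  by rewrite mulgA -delta_liftingE mulgVK.
rewrite tM !del_delta (derivation1 sM) invg1 lifting1r invg1 mul1g.
move=> /mulIg; rewrite !mfM sM -map_del -ScE actEK !invgM !pactA.
do 4!move/pact_inj; move=> xE.
by rewrite /tgtL xE map_lifting mulVKg.
Qed.

Definition target_map : xmod2_map C D :=
  @XMod2Map C D (mk_mult tgtL_M) (mk_mult tgtE_M) (mk_mult tgtG_M)
    tgt_delta tgt_del tgt_actL (fun g a => tgtE_act g a sM tA) tgt_lifting.
End Target.

Definition target (C D : xmod2) (h : homotopy C D) : xmod2_map C D :=
  target_map (h_quadratic h).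

Lemma pactU (D : xmod2) (e : grpE D) (l : grpL D) : e |>' l = e |>p l.
Proof. by rewrite pact.unlock. Qed.

(** * Concatenation over a free group *)

Section FreeBasis.
Variables (C D : xmod2) (X : triangles D) (B : set (grpG C)).
Hypothesis B_free : free_basis B.
Implicit Types (phi : {multiplicative grpG C -> grpG D}).
Implicit Types (s u : grpG C -> grpE D) (w k : grpG C -> grpL D).

Local Notation tri := (tri X).

Lemma free_ext (H : groupType) (u : grpG C -> H) :
  exists2 v : grpG C -> H, {morph v : x y / x * y} & forall b, B b -> v b = u b.
Proof. by have [v [vB _]] := B_free u; exists v => //; apply: mfM. Qed.

Lemma free_uniq (H : groupType) (v v' : grpG C -> H) :
  {morph v : x y / x * y} -> {morph v' : x y / x * y} ->
  (forall b, B b -> v b = v' b) -> v =1 v'.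
Proof.
move=> vM vM' vv' x; have [v0 [_ uq]] := B_free v.
have e1 : v0 = mk_mult vM by apply: uq.
have e2 : v0 = mk_mult vM' by apply: uq => b Bb; rewrite vv'.
by rewrite -[LHS]/(mk_mult vM x) -[RHS]/(mk_mult vM' x) -e1 e2.
Qed.

Lemma derivation_uniq phi s s' : is_derivation phi s -> is_derivation phi s' ->
  (forall b, B b -> s b = s' b) -> s =1 s'.
Proof.
move=> /(derivationP X) sM /(derivationP X) sM' ss' x.
suff /tri_inj[] : tri (phi x) (s x) 1 1 = tri (phi x) (s' x) 1 1 by [].
by apply: (free_uniq sM sM') => b Bb; rewrite ss'.
Qed.

Definition omega_spec phi s s' w :=
  {morph (fun x => tri (phi x) (s x) (s' x) (w x)^-1) : x y / x * y} /\
  forall b, B b -> w b = 1.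

Lemma omega_uniq phi s s' w w' :
  omega_spec phi s s' w -> omega_spec phi s s' w' -> w =1 w'.
Proof.
move=> [wM w1] [wM' w1'] x.
suff /tri_inj[_ _ _ /invg_inj] : tri (phi x) (s x) (s' x) (w x)^-1 =
  tri (phi x) (s x) (s' x) (w' x)^-1 by [].
by apply: (free_uniq wM wM') => b Bb; rewrite w1 ?w1'.
Qed.

(** Freeness extends the triangles with label 1 from B to a homomorphism. Its first three
    coordinates satisfy the same rules as [phi], s and s' and agree with them on B, hence
    everywhere; the inverse of the label is ω. *)
Lemma omega_exists phi phi' s s' : is_derivation phi s ->
  (forall g, phi' g = phi g * del (s g)) -> is_derivation phi' s' ->
  exists w, omega_spec phi s s' w.
Proof.
move=> sM phiE sM'.
have [z zM zB] := free_ext (fun b => tri (phi b) (s b) (s' b) 1).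
have /choice[c cE] x : exists c : grpG D * grpE D * grpE D * grpL D,
    z x = tri c.1.1.1 c.1.1.2 c.1.2 c.2.
  by have [g [u [v [l zE]]]] := tri_surj (z x); exists (g, u, v, l).
have cB b : B b -> [/\ (c b).1.1.1 = phi b, (c b).1.1.2 = s b,
    (c b).1.2 = s' b & (c b).2 = 1].
  by move=> Bb; apply: (@tri_inj _ X); rewrite -cE zB.
have gE x : (c x).1.1.1 = phi x.
  apply: (free_uniq (v := fun x => (c x).1.1.1)) => [{}x y||b /cB[]//].
    by have := zM x y; rewrite !cE triM => /tri_inj[].
  exact: mfM.
have uE x : (c x).1.1.2 = s x.
  apply: (derivation_uniq (phi := phi) (s := fun x => (c x).1.1.2)) => //;
    last by move=> b /cB[].
  move=> {}x y.
  by have := zM x y; rewrite !cE triM !gE => /tri_inj[].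
have vE x : (c x).1.2 = s' x.
  apply: (derivation_uniq (phi := phi') (s := fun x => (c x).1.2)) => //;
    last by move=> b /cB[].
  move=> {}x y.
  have := zM x y; rewrite !cE triM !gE !uE => /tri_inj[_ _ -> _].
  by rewrite phiE invgM -(mfV del) actEA.
exists (fun x => (c x).2^-1); split=> [x y|b /cB[_ _ _ ->]]; last exact: invg1.
by have := zM x y; rewrite !cE !gE !uE !vE !invgK.
Qed.

(** The recursion is the inverse of the label in [triM]: [lifting_deltaM] moves δ(w x) out of the
    lifting, and what it leaves behind cancels the action of φ'(y)^-1 on w x. *)
Lemma is_omegaP (h h' : homotopy C D) w :
  target h = hmap h' ->
  is_omega B h h' w <-> omega_spec (mapG (hmap h)) (hs h) (hs h') w.
Proof.
move=> hh'.
have [sM _ _] := h_quadratic h; have [sM' _ _] := h_quadratic h'.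
have phiE g : mapG (hmap h') g = mapG (hmap h) g * del (hs h g) by rewrite -hh'.
have E x y : (hs h' y)^-1 |>p
      ((lifting (hs h y)^-1 ((mapG (hmap h) y)^-1 |>E (hs h' x)^-1))^-1 *
       ((hs h y)^-1 |>p ((mapG (hmap h) y)^-1 |>L (w x)^-1))) * (w y)^-1 =
   (w y * ((hs h' y)^-1 |>'
        (lifting (hs h y)^-1
                 ((mapG (hmap h) y)^-1 |>E (delta (w x) * (hs h' x)^-1))
         * ((mapG (hmap h') y)^-1 |>L w x))))^-1.
  rewrite pactU invgM -pactV; congr ((_ |>p _) * _).
  rewrite actEM -delta_act lifting_deltaM phiE (invgM (mapG _ _)) actLA.
  by rewrite (mfV del) mulgVK invgM actLV pactV.
have EM x y :
    tri (mapG (hmap h) (x * y)) (hs h (x * y)) (hs h' (x * y)) (w (x * y))^-1 =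
    tri (mapG (hmap h) x) (hs h x) (hs h' x) (w x)^-1 *
    tri (mapG (hmap h) y) (hs h y) (hs h' y) (w y)^-1 <->
    w (x * y) = w y * ((hs h' y)^-1 |>'
        (lifting (hs h y)^-1
                 ((mapG (hmap h) y)^-1 |>E (delta (w x) * (hs h' x)^-1))
         * ((mapG (hmap h') y)^-1 |>L w x))).
  rewrite triM E mfM sM sM' phiE (invgM (mapG _ _)) -(mfV del) actEA.
  by split=> [/tri_inj[_ _ _ /invg_inj]|->].
by split=> -[H1 H2]; split=> // x y; apply/EM.
Qed.
End FreeBasis.

(** * Extensionality for maps, homotopies and 2-fold homotopies *)

Section MapEq.
Variables C D : xmod2.

Lemma mult_eq (G H : groupType) (u v : {multiplicative G -> H}) :
  u =1 v -> u = v.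
Proof.
case: u v => [u [[uM]]] [v [[vM]]] /= /funext uv.
case: _ / uv in vM *.
by rewrite (Prop_irrelevance uM vM).
Qed.

Lemma xmod2_map_eq (f f' : xmod2_map C D) :
  mapL f =1 mapL f' -> mapE f =1 mapE f' -> mapG f =1 mapG f' -> f = f'.
Proof.
case: f f' => [L E G a1 a2 a3 a4 a5] [L' E' G' b1 b2 b3 b4 b5] /=.
move=> /mult_eq eL /mult_eq eE /mult_eq eG.
case: _ / eL in b1 b2 b3 b4 b5 *; case: _ / eE in b1 b2 b3 b4 b5 *.
case: _ / eG in b1 b2 b3 b4 b5 *.
by congr XMod2Map; apply: Prop_irrelevance.
Qed.

Lemma homotopy_eq (h h' : homotopy C D) :
  hmap h = hmap h' -> hs h =1 hs h' -> ht h =1 ht h' -> h = h'.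
Proof.
case: h h' => [f s t a] [f' s' t' a'] /= ef /funext es /funext et.
case: _ / ef in a' *; case: _ / es in a' *; case: _ / et in a' *.
by congr Homotopy; apply: Prop_irrelevance.
Qed.

Lemma homotopy2_eq (a a' : homotopy2 C D) :
  khom a = khom a' -> kfun a =1 kfun a' -> a = a'.
Proof.
case: a a' => [h k a] [h' k' a'] /= eh /funext ek.
case: _ / eh in a' *; case: _ / ek in a' *.
by congr Homotopy2; apply: Prop_irrelevance.
Qed.
End MapEq.

Section Concatenation.
Variables (C D : xmod2) (B : set (grpG C)).
Hypothesis B_free : free_basis B.
Implicit Types (h : homotopy C D).

Let X : triangles D := triangles_exist D.

(* The junk value 1 is only taken when h and h' are not composable. *)
Definition omega (h h' : homotopy C D) : grpG C -> grpL D :=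
  let P := omega_spec X B (mapG (hmap h)) (hs h) (hs h') in
  if pselect (exists w, P w) is left e then sval (cid e) else fun=> 1.

Lemma hs_derivation h : is_derivation (mapG (hmap h)) (hs h).
Proof. by have [] := h_quadratic h. Qed.

Lemma target_mapG h h' : target h = hmap h' ->
  forall g, mapG (hmap h') g = mapG (hmap h) g * del (hs h g).
Proof. by move=> <-. Qed.

Lemma target_mapE h h' : target h = hmap h' ->
  forall a, mapE (hmap h') a = tgtE (hmap h) (hs h) (ht h) a.
Proof. by move=> <-. Qed.

Lemma omegaP h h' : target h = hmap h' ->
  omega_spec X B (mapG (hmap h)) (hs h) (hs h') (omega h h').
Proof.
move=> hh'; rewrite /omega; case: pselect => [e|[]]; first exact: svalP.
exact: (omega_exists X B_free (hs_derivation h) (target_mapG hh')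
  (hs_derivation h')).
Qed.

Lemma omegaE h h' w : target h = hmap h' ->
  omega_spec X B (mapG (hmap h)) (hs h) (hs h') w -> omega h h' =1 w.
Proof. by move=> hh' ww; apply: omega_uniq (omegaP hh') ww. Qed.

(** A closed form of the derivation with values s(b) s'(b) on B, where ω is 1: the long edge of the
    triangle that encodes ω. *)
Definition concat_s h h' x := hs h x * hs h' x * (delta (omega h h' x))^-1.
Definition concat_t h h' a :=
  omega h h' (del a) * ((hs h' (del a))^-1 |>p ht h a) * ht h' a.

Section Concat.
Variables (h h' : homotopy C D).
Hypothesis hh' : target h = hmap h'.

Fact concat_quad :
  is_quadratic_derivation (hmap h) (concat_s h h') (concat_t h h').
Proof.
apply: (comp_quad3 (X := X)) (h_quadratic h) (h_quadratic h').
- exact: hs_derivation.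
- exact: target_mapG.
- exact: target_mapE.
- exact: (omegaP hh').1.
- by [].
- by [].
Qed.

Definition concat : homotopy C D := Homotopy concat_quad.

Lemma omega1 : omega h h' 1 = 1.
Proof.
have := morphg1 (omegaP hh').1; rewrite -(tri1 X) => /tri_inj[_ _ _] wE.
by rewrite -[LHS]invgK wE invg1.
Qed.

Lemma target_concat : target concat = target h'.
Proof.
have phiE := target_mapG hh'; have psiE := target_mapE hh'.
have sM := hs_derivation h.
apply: xmod2_map_eq => [l|a|g].
- rewrite /= /tgtL /= /concat_t del_delta -hh' /= /tgtL omega1.
  by rewrite (derivation1 (hs_derivation h')) invg1 pact1 mul1g !mulgA.
- exact: comp_tgtE psiE _ _ a.
- exact: comp_tgtG phiE _ g.
Qed.

Lemma concat_sM : is_derivation (mapG (hmap h)) (concat_s h h').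
Proof. by have [] := concat_quad. Qed.

Lemma concat_sB b : B b -> concat_s h h' b = hs h b * hs h' b.
Proof. by move=> Bb; rewrite /concat_s (omegaP hh').2 // mf1 invg1 mulg1. Qed.

Lemma is_concat_concat : is_concat B h h' concat.
Proof.
split=> //=.
- split=> [|u [uM uB]].
    by split; [exact: concat_sM | exact: concat_sB].
  apply: funext => x; apply: (derivation_uniq X B_free concat_sM uM) => b Bb.
  by rewrite uB ?concat_sB.
- exists (omega h h'); last by move=> e; rewrite pactU.
  split=> [|w ww]; first by apply/(is_omegaP X B _ hh'); exact: omegaP.
  apply: funext; apply: omegaE => //; exact/(is_omegaP X B _ hh').
Qed.
End Concat.

Fact id_quad (f : xmod2_map C D) :
  is_quadratic_derivation f (fun=> 1) (fun=> 1).
Proof.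
apply/quadratic_derivationE; split=> [x y|a b|g a].
- by rewrite actEg1 mulg1.
- by rewrite !gsimpD.
- by rewrite !gsimpD.
Qed.

Definition id_homotopy f : homotopy C D := Homotopy (id_quad f).

Lemma target_id f : target (id_homotopy f) = f.
Proof.
by apply: xmod2_map_eq => x; rewrite /= /tgtL /tgtE /tgtG /= ?mf1 !mulg1.
Qed.

Lemma concat_idl h (p : target (id_homotopy (hmap h)) = hmap h) :
  concat p = h.
Proof.
have w1 : omega (id_homotopy (hmap h)) h =1 fun=> 1.
  apply: omegaE => //; split=> //= x y.
  by rewrite triM (hs_derivation h) !gsimpD mfM.
apply: homotopy_eq => //= x; rewrite /concat_s /concat_t /= w1 ?mf1 !gsimpD //.
Qed.

Lemma concat_idr h (p : target h = hmap (id_homotopy (target h))) :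
  concat p = h.
Proof.
have w1 : omega h (id_homotopy (target h)) =1 fun=> 1.
  apply: omegaE => //; split=> //= x y.
  by rewrite triM (hs_derivation h) !gsimpD mfM.
apply: homotopy_eq => //= x; rewrite /concat_s /concat_t /= w1 ?mf1 !gsimpD //.
Qed.

(** At each x the edges s1, s2, s3 span a tetrahedron with three faces given by known ω. Its face
    013 is therefore multiplicative, and uniqueness of ω expresses [omega h1 (concat q)] through the
    other three. *)
Lemma concatA h1 h2 h3 (p : target h1 = hmap h2) (q : target h2 = hmap h3)
    (p' : target h1 = hmap (concat q)) (q' : target (concat p) = hmap h3) :
  concat q' = concat p'.
Proof.
pose w := omega (concat p) h3; pose w12 := omega h1 h2; pose w23 := omega h2 h3.
have [M M1] := omegaP q'; have [M12 B12] := omegaP p.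
have [M23 B23] := omegaP q.
have T x : tet (tri X (mapG (hmap h1) x) (hs h1 x) (hs h2 x) (w12 x)^-1)
  (tri X (mapG (hmap h1) x) (concat_s h1 h2 x) (hs h3 x) (w x)^-1)
  (tri X (mapG (hmap h2) x) (hs h2 x) (hs h3 x) (w23 x)^-1)
  (tri X (mapG (hmap h1) x) (hs h1 x) (concat_s h2 h3 x)
    (w x * ((hs h3 x)^-1 |>p w12 x) * (w23 x)^-1)^-1).
  exists (mapG (hmap h1) x), (hs h1 x), (hs h2 x), (hs h3 x).
  exists (w12 x)^-1, (w x)^-1, (w23 x)^-1.
  by rewrite /concat_s !(mfV delta) !invgM !invgK pactV (target_mapG p) !mulgA.
have w' : omega h1 (concat q) =1
    fun x => w x * ((hs h3 x)^-1 |>p w12 x) * (w23 x)^-1.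
  apply: omegaE => //; split=> [x y|b Bb]; last first.
    by rewrite /w /w12 /w23 M1 ?B12 ?B23 // pactg1 !gsimp.
  apply: tet_uniq013 (T (x * y)) _.
  rewrite M M12 M23; exact: tet_mul.
apply: homotopy_eq => //= x.
  rewrite /concat_s -/w -/w12 /= w' /concat_s -/w12 -/w23.
  by rewrite !(mfM delta, mfV delta, delta_pact) !gnorm.
rewrite /concat_t -/w -/w12 /= w' /concat_t /concat_s -/w12 -/w23 /=.
by rewrite !invgM !invgK !pactA pact_delta !pactM !gnorm.
Qed.
End Concatenation.

(** * Inverses of homotopies *)

Section Inverse.
Variables (C D : xmod2) (B : set (grpG C)).
Hypothesis B_free : free_basis B.

Let X : triangles D := triangles_exist D.

Lemma derivation_exists (phi : {multiplicative grpG C -> grpG D})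
    (s0 : grpG C -> grpE D) :
  exists2 s, is_derivation phi s & forall b, B b -> s b = s0 b.
Proof.
have [z zM zB] := free_ext B_free (fun b => tri X (phi b) (s0 b) 1 1).
have /choice[c cE] x : exists c : grpG D * grpE D * grpE D * grpL D,
    z x = tri X c.1.1.1 c.1.1.2 c.1.2 c.2.
  by have [g [u [v [l zE]]]] := tri_surj (z x); exists (g, u, v, l).
have cB b : B b -> (c b).1.1.1 = phi b /\ (c b).1.1.2 = s0 b.
  by move=> /zB; rewrite cE => /tri_inj[].
have gE x : (c x).1.1.1 = phi x.
  apply: (free_uniq B_free (v := fun x => (c x).1.1.1)) => [{}x y||b /cB[]//].
    by have := zM x y; rewrite !cE triM => /tri_inj[].
  exact: mfM.
exists (fun x => (c x).1.1.2) => [x y|b /cB[]//].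
by have := zM x y; rewrite !cE triM !gE => /tri_inj[].
Qed.

(** Let s' be the derivation equal to s(b)^-1 on B. With the trivial pair in the role of (s3, t3),
    [comp_quad2] applies; t' is then forced by t3 = 1. *)
Lemma concat_rinv (h : homotopy C D) :
  exists h' (p : target h = hmap h'), concat B_free p = id_homotopy (hmap h).
Proof.
have [s' sM' sB] := derivation_exists (mapG (target h)) (fun b => (hs h b)^-1).
have sM := hs_derivation h.
have [w [wM wB]] :=
  omega_exists X B_free (phi' := mapG (target h)) sM (fun=> erefl) sM'.
(* Both sides are derivations that are trivial on B. *)
have s1E x : 1 = hs h x * s' x * (delta (w x))^-1.
  suff : (fun=> 1) =1 fun x => hs h x * s' x * (delta (w x))^-1.
    by move=> /(_ x).
  apply: (derivation_uniq X B_free (phi := mapG (hmap h))).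
  - by move=> ? ?; rewrite actEg1 mulg1.
  - by apply: (comp_s3M (X := X) (s1 := hs h) (s2 := s') (w := w)).
  - by move=> b Bb; rewrite sB // wB // mf1 invg1 mulgV mulg1.
pose t' a := (w (del a) * ((s' (del a))^-1 |>p ht h a))^-1.
have q : is_quadratic_derivation (target h) s' t'.
  apply: (comp_quad2 (X := X) (f := hmap h) (w := w))
    (h_quadratic h) (id_quad _) => //.
  by move=> a; rewrite /t' mulgV.
pose h' := Homotopy q; have hh' : target h = hmap h' by [].
have ww : omega B h h' =1 w by apply: omegaE.
exists h', hh'; apply: homotopy_eq => //= x.
  by rewrite /concat_s ww -s1E.
by rewrite /concat_t ww /= /t' mulgV.
Qed.

Lemma concat_congr (h h' k k' : homotopy C D)
    (p : target h = hmap h') (q : target k = hmap k') :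
  h = k -> h' = k' -> concat B_free p = concat B_free q.
Proof. by move=> e e'; subst k k'; rewrite (Prop_irrelevance p q). Qed.

(** By associativity, a right inverse of a right inverse of h is h itself, so right inverses are
    two-sided. *)
Lemma concat_inv (h : homotopy C D) :
  exists h' (p : target h = hmap h') (q : target h' = hmap h),
    concat B_free p = id_homotopy (hmap h) /\
    concat B_free q = id_homotopy (target h).
Proof.
have [h' [p pE]] := concat_rinv h; have [h2 [q qE]] := concat_rinv h'.
have q' : target h' = hmap h by rewrite -(target_concat B_free p) pE target_id.
suff h2E : h = h2 by subst h2; exists h', p, q; rewrite qE p.
have r : target h = hmap (concat B_free q) by rewrite /= p.
have r' : target (concat B_free p) = hmap h2 by rewrite target_concat.
have h2f : hmap h2 = hmap h by rewrite -q.
have i2 : target (id_homotopy (hmap h2)) = hmap h2 by rewrite target_id.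
have i1 : target h = hmap (id_homotopy (target h)) by [].
rewrite -(concat_idl B_free i2) -(concat_idr B_free i1).
transitivity (concat B_free r).
  by apply: concat_congr => //; rewrite qE p.
by rewrite -(concatA r r'); apply: concat_congr => //; rewrite pE h2f.
Qed.
End Inverse.

(** * 2-fold homotopies and whiskering *)

Section Cells.
Variables (C D : xmod2) (B : set (grpG C)).
Hypothesis B_free : free_basis B.
Implicit Types (h : homotopy C D) (a b : homotopy2 C D).

Let X : triangles D := triangles_exist D.

Lemma is_2derivationP h k : is_2derivation h k <->
  {morph (fun x => tri X (mapG (hmap h) x) 1 (hs h x * delta (k x)) (k x)^-1)
    : x y / x * y}.
Proof.
have E x y : tri X (mapG (hmap h) x) 1 (hs h x * delta (k x)) (k x)^-1 *
    tri X (mapG (hmap h) y) 1 (hs h y * delta (k y)) (k y)^-1 =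
  let m := ((hs h y)^-1 |>p ((mapG (hmap h) y)^-1 |>L k x)) * k y in
  tri X (mapG (hmap h) (x * y)) 1 (hs h (x * y) * delta m) m^-1.
  rewrite triM !gsimpD mfM (hs_derivation h) actEM -delta_act /=; congr tri.
    by rewrite !(mfM delta, delta_pact) !gnorm.
  by rewrite (invgM (hs h y)) -(mfV delta) pactA pact_delta actLV !pactV !gnorm.
split=> kM x y.
  by rewrite E kM pactU.
by have := kM x y; rewrite E => /tri_inj[_ _ _ /invg_inj ->]; rewrite pactU.
Qed.

Lemma kfun1 a : kfun a 1 = 1.
Proof.
by apply: mulg_idem; rewrite -{1}(mulg1 1) k_2derivation pactU mf1
  (derivation1 (hs_derivation _)) !invg1 actL1 pact1.
Qed.

Lemma id_tgtE (f : xmod2_map C D) x : mapE f x = tgtE f (fun=> 1) (fun=> 1) x.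
Proof. by rewrite /tgtE mf1 !mulg1. Qed.

Fact target2_quad a : is_quadratic_derivation (hmap (khom a))
  (fun x => hs (khom a) x * delta (kfun a x))
  (fun e => (kfun a (del e))^-1 * ht (khom a) e).
Proof.
apply: (comp_quad2 (X := X) (f := hmap (khom a)) (w := kfun a))
  (id_quad _) (h_quadratic (khom a)).
- by case: (id_quad (hmap (khom a))).
- by move=> g; rewrite mf1 mulg1.
- exact: id_tgtE.
- by apply/is_2derivationP; exact: k_2derivation.
- by move=> x; rewrite !gnorm.
- by move=> x; rewrite pactg1 !gsimp mulVKg.
Qed.

Definition target2 a : homotopy C D := Homotopy (target2_quad a).

Lemma target_target2 a : target (target2 a) = target (khom a).
Proof.
apply: xmod2_map_eq => x; rewrite /= /tgtL /tgtE /tgtG /=.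
- by rewrite del_delta kfun1 invg1 mul1g.
- by rewrite (mfM delta) (mfV delta) !gnorm.
- by rewrite (mfM del) del_delta mulg1.
Qed.

(** This reduces the whiskering laws and the interchange law to values on B, where no ω appears. *)
Lemma homotopy2_eqB a b : khom a = khom b ->
  (forall x, B x -> kfun a x = kfun b x) -> a = b.
Proof.
move=> e kB; apply: homotopy2_eq => // x.
have /is_2derivationP aM := @k_2derivation _ _ a.
have /is_2derivationP bM := @k_2derivation _ _ b.
rewrite -e in bM.
suff /tri_inj[_ _ _ /invg_inj] : tri X (mapG (hmap (khom a)) x) 1
    (hs (khom a) x * delta (kfun a x)) (kfun a x)^-1 =
  tri X (mapG (hmap (khom a)) x) 1
    (hs (khom a) x * delta (kfun b x)) (kfun b x)^-1 by [].
by apply: (free_uniq B_free aM bM) => y By; rewrite kB.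
Qed.

Fact vcomp_2der a b : target2 a = khom b ->
  is_2derivation (khom a) (fun x => kfun a x * kfun b x).
Proof.
move=> ab x y; rewrite !k_2derivation !pactU -ab /=.
by rewrite actLM pactM invgM -(mfV delta) pactA pact_delta !gnorm.
Qed.

Definition vcomp a b (p : target2 a = khom b) := Homotopy2 (vcomp_2der p).

Lemma target2_vcomp a b (p : target2 a = khom b) : target2 (vcomp p) = target2 b.
Proof.
by apply: homotopy_eq => [|x|x] /=; rewrite -p //= ?(mfM delta) ?invgM !mulgA.
Qed.

Fact id2_2der h : is_2derivation h (fun=> 1).
Proof. by move=> x y; rewrite pactU actLg1 pactg1 mulg1. Qed.

Definition id_homotopy2 h := Homotopy2 (id2_2der h).

Lemma target2_id h : target2 (id_homotopy2 h) = h.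
Proof. by apply: homotopy_eq => //= x; rewrite ?mf1 !gsimp. Qed.

Fact vinv_2der a : is_2derivation (target2 a) (fun x => (kfun a x)^-1).
Proof.
move=> x y; rewrite k_2derivation !pactU /=.
by rewrite (invgM (hs _ _)) -(mfV delta) pactA pact_delta !(actLV, pactV) !gnorm.
Qed.

Definition vinv a := Homotopy2 (vinv_2der a).

Lemma target2_vinv a : target2 (vinv a) = khom a.
Proof. by apply: homotopy_eq => //= x; rewrite ?(mfV delta) !gnorm. Qed.
End Cells.

Section Whiskering.
Variables (C D : xmod2) (B : set (grpG C)).
Hypothesis B_free : free_basis B.
Implicit Types (h : homotopy C D) (a b : homotopy2 C D).

Let X : triangles D := triangles_exist D.

Lemma target_target2_eq a h :
  target (khom a) = hmap h -> target (target2 a) = hmap h.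
Proof. by rewrite target_target2. Qed.

Section Right.
Variables (a : homotopy2 C D) (h : homotopy C D).
Hypothesis ah : target (khom a) = hmap h.
Let ah' : target (target2 a) = hmap h := target_target2_eq ah.
Let w := omega B (khom a) h.
Let w' := omega B (target2 a) h.

(** A closed form on the whole group; on B both ω are 1 and the prescribed value remains. *)
Definition whiskr_fun x :=
  omega B (khom a) h x * ((hs h x)^-1 |>p kfun a x) *
  (omega B (target2 a) h x)^-1.

Lemma whiskr_s x : concat_s B (khom a) h x * delta (whiskr_fun x) =
  concat_s B (target2 a) h x.
Proof.
rewrite /concat_s /whiskr_fun !(mfM delta, delta_pact) (mfV delta).
by rewrite !gnorm.
Qed.

(** The tetrahedron with edges 1, s δ(k) and the edge of h has as faces the triangle of k and two
    ω-triangles, all multiplicative; its face 013 encodes [whiskr_fun]. *)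
Fact whiskr_2der : is_2derivation (concat B_free ah) whiskr_fun.
Proof.
apply/(is_2derivationP) => x y.
have T z : tet
    (tri X (mapG (hmap (khom a)) z) 1
      (hs (khom a) z * delta (kfun a z)) (kfun a z)^-1)
    (tri X (mapG (hmap (khom a)) z) (hs (khom a) z) (hs h z) (w z)^-1)
    (tri X (mapG (hmap (khom a)) z) (hs (target2 a) z) (hs h z) (w' z)^-1)
    (tri X (mapG (hmap (khom a)) z) 1
      (concat_s B (khom a) h z * delta (whiskr_fun z)) (whiskr_fun z)^-1).
  rewrite whiskr_s.
  exists (mapG (hmap (khom a)) z), 1, (hs (target2 a) z), (hs h z),
    (kfun a z)^-1, (w z)^-1, (w' z)^-1.
  by rewrite /whiskr_fun /concat_s !(mfV delta) !invgM !pactV mf1 !gnorm.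
have /is_2derivationP aM := @k_2derivation _ _ a.
have [wM _] := omegaP B_free ah; have [wM' _] := omegaP B_free ah'.
apply: tet_uniq013 (T (x * y)) _.
rewrite aM wM wM'; exact: tet_mul.
Qed.

Definition whisker_r := Homotopy2 whiskr_2der.

Lemma whiskr_B x : B x -> whiskr_fun x = (hs h x)^-1 |>p kfun a x.
Proof.
move=> Bx; rewrite /whiskr_fun (omegaP B_free ah).2 // (omegaP B_free ah').2 //.
by rewrite !gsimp.
Qed.

Lemma target2_whiskr (p' : target (target2 a) = hmap h) :
  target2 whisker_r = concat B_free p'.
Proof.
apply: homotopy_eq => //= x; first exact: whiskr_s.
rewrite /concat_t /whiskr_fun /= -/w -/w' !invgM invgK pactM pactV.
by rewrite !gnorm.
Qed.
End Right.

Section Left.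
Variables (h : homotopy C D) (a : homotopy2 C D).
Hypothesis ha : target h = hmap (khom a).
Let ha' : target h = hmap (target2 a) := ha.
Let w := omega B h (khom a).
Let w' := omega B h (target2 a).

Definition whiskl_fun x :=
  omega B h (khom a) x * kfun a x * (omega B h (target2 a) x)^-1.

Lemma whiskl_s x : concat_s B h (khom a) x * delta (whiskl_fun x) =
  concat_s B h (target2 a) x.
Proof.
rewrite /concat_s /whiskl_fun !(mfM delta) (mfV delta) /=.
by rewrite !gnorm.
Qed.

Fact whiskl_2der : is_2derivation (concat B_free ha) whiskl_fun.
Proof.
apply/(is_2derivationP).
have /is_2derivationP aM := @k_2derivation _ _ a.
have [wM _] := omegaP B_free ha; have [wM' _] := omegaP B_free ha'.
have hM := hs_derivation h.
(* Whiskering on this side takes two tetrahedra: this auxiliary triangle is face 013 of the first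
   and face 123 of the second. *)
have YM : {morph (fun z => tri X (mapG (hmap h) z) (hs h z) (hs (khom a) z)
    (kfun a z * (w' z)^-1)) : x y / x * y}.
  have T z : tet
      (tri X (mapG (hmap h) z) (hs h z) 1 1)
      (tri X (mapG (hmap h) z) (hs h z) (hs (target2 a) z) (w' z)^-1)
      (tri X (mapG (hmap (khom a)) z) 1
        (hs (khom a) z * delta (kfun a z)) (kfun a z)^-1)
      (tri X (mapG (hmap h) z) (hs h z) (hs (khom a) z) (kfun a z * (w' z)^-1)).
    exists (mapG (hmap h) z), (hs h z), 1, (hs (target2 a) z),
      1, (w' z)^-1, (kfun a z)^-1.
    by rewrite (target_mapG ha) (mfV delta) mf1 pactg1 !gnorm.
  move=> x y; apply: tet_uniq013 (T (x * y)) _.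
  rewrite ((derivationP X _ _).1 hM) aM wM'; exact: tet_mul.
have T z : tet
    (tri X (mapG (hmap h) z) 1 (hs h z) 1)
    (tri X (mapG (hmap h) z) (hs h z) (hs (khom a) z) (w z)^-1)
    (tri X (mapG (hmap h) z) (hs h z) (hs (khom a) z) (kfun a z * (w' z)^-1))
    (tri X (mapG (hmap h) z) 1
      (concat_s B h (khom a) z * delta (whiskl_fun z)) (whiskl_fun z)^-1).
  exists (mapG (hmap h) z), 1, (hs h z), (hs (khom a) z), 1, (w z)^-1.
  exists (kfun a z * (w' z)^-1).
  by rewrite /concat_s /whiskl_fun !(mfM delta) !(mfV delta) !mf1 pactg1 !gnorm.
move=> x y; apply: tet_uniq013 (T (x * y)) _.
rewrite (tri_barM X hM) YM wM; exact: tet_mul.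
Qed.

Definition whisker_l := Homotopy2 whiskl_2der.

Lemma whiskl_B x : B x -> whiskl_fun x = kfun a x.
Proof.
move=> Bx; rewrite /whiskl_fun (omegaP B_free ha).2 // (omegaP B_free ha').2 //.
by rewrite !gsimp.
Qed.

Lemma target2_whiskl (p' : target h = hmap (target2 a)) :
  target2 whisker_l = concat B_free p'.
Proof.
apply: homotopy_eq => //= x; first exact: whiskl_s.
rewrite /concat_t /whiskl_fun /= -/w -/w' !invgM invgK -(mfV delta) pactA.
by rewrite pact_delta !gnorm.
Qed.
End Left.
End Whiskering.

(** * The 2-groupoid *)

Section TwoGroupoid.
Variables (C D : xmod2) (B : set (grpG C)).
Hypothesis B_free : free_basis B.
Implicit Types (f g h : homotopy C D) (a b c : homotopy2 C D).

Local Notation concat := (concat B_free).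
Local Notation rwhisker := (whisker_r B_free).
Local Notation lwhisker := (whisker_l B_free).

Lemma vcomp_idl a (p : target2 (id_homotopy2 (khom a)) = khom a) : vcomp p = a.
Proof. by apply: homotopy2_eq => //= x; rewrite mul1g. Qed.

Lemma vcomp_idr a (p : target2 a = khom (id_homotopy2 (target2 a))) :
  vcomp p = a.
Proof. by apply: homotopy2_eq => //= x; rewrite mulg1. Qed.

Lemma vcompA a b c (p : target2 a = khom b) (q : target2 b = khom c)
    (p' : target2 a = khom (vcomp q)) (q' : target2 (vcomp p) = khom c) :
  vcomp q' = vcomp p'.
Proof. by apply: homotopy2_eq => //= x; rewrite mulgA. Qed.

Lemma vcomp_vinv a (p : target2 a = khom (vinv a)) :
  vcomp p = id_homotopy2 (khom a).
Proof. by apply: homotopy2_eq => //= x; rewrite mulgV. Qed.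

Lemma vinv_vcomp a (p : target2 (vinv a) = khom a) :
  vcomp p = id_homotopy2 (target2 a).
Proof. by apply: homotopy2_eq => //= x; rewrite mulVg. Qed.

Lemma rwhisker_id2 f g (p : target f = hmap g)
    (p' : target (khom (id_homotopy2 f)) = hmap g) :
  rwhisker p' = id_homotopy2 (concat p).
Proof.
apply: (homotopy2_eqB B_free) => [|x Bx] /=; first exact: concat_congr.
by rewrite whiskr_B // pactg1.
Qed.

Lemma rwhisker_vcomp a b g (p : target2 a = khom b)
    (q : target (khom (vcomp p)) = hmap g) (q' : target (khom a) = hmap g)
    (q'' : target (khom b) = hmap g)
    (p' : target2 (rwhisker q') = khom (rwhisker q'')) :
  rwhisker q = vcomp p'.
Proof.
apply: (homotopy2_eqB B_free) => [|x Bx] /=; first exact: concat_congr.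
by rewrite !whiskr_B // pactM.
Qed.

Lemma rwhisker_id1 a
    (p : target (khom a) = hmap (id_homotopy (target (khom a)))) :
  rwhisker p = a.
Proof.
apply: (homotopy2_eqB B_free) => [|x Bx] /=; first exact: concat_idr.
by rewrite whiskr_B // invg1 pact1.
Qed.

Lemma rwhisker_concat a g h (p : target g = hmap h)
    (q : target (khom a) = hmap (concat p)) (q' : target (khom a) = hmap g)
    (p' : target (khom (rwhisker q')) = hmap h) :
  rwhisker q = rwhisker p'.
Proof.
apply: (homotopy2_eqB B_free) => [|x Bx] /=; first exact: esym (concatA _ _).
by rewrite !whiskr_B //= whiskr_B // concat_sB // invgM pactA.
Qed.

Lemma lwhisker_id2 f g (p : target f = hmap g)
    (p' : target f = hmap (khom (id_homotopy2 g))) :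
  lwhisker p' = id_homotopy2 (concat p).
Proof.
apply: (homotopy2_eqB B_free) => [|x Bx] /=; first exact: concat_congr.
by rewrite whiskl_B.
Qed.

Lemma lwhisker_vcomp f a b (p : target2 a = khom b)
    (q : target f = hmap (khom (vcomp p))) (q' : target f = hmap (khom a))
    (q'' : target f = hmap (khom b))
    (p' : target2 (lwhisker q') = khom (lwhisker q'')) :
  lwhisker q = vcomp p'.
Proof.
apply: (homotopy2_eqB B_free) => [|x Bx] /=; first exact: concat_congr.
by rewrite !whiskl_B.
Qed.

Lemma lwhisker_id1 a
    (p : target (id_homotopy (hmap (khom a))) = hmap (khom a)) :
  lwhisker p = a.
Proof.
apply: (homotopy2_eqB B_free) => [|x Bx] /=; first exact: concat_idl.
by rewrite whiskl_B.
Qed.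

Lemma lwhisker_concat f g a (p : target f = hmap g)
    (q : target (concat p) = hmap (khom a)) (q' : target g = hmap (khom a))
    (p' : target f = hmap (khom (lwhisker q'))) :
  lwhisker q = lwhisker p'.
Proof.
apply: (homotopy2_eqB B_free) => [|x Bx] /=; first exact: concatA.
by rewrite !whiskl_B //= whiskl_B.
Qed.

Lemma rwhisker_lwhisker f a h (p : target f = hmap (khom a))
    (q : target (khom (lwhisker p)) = hmap h) (q' : target (khom a) = hmap h)
    (p' : target f = hmap (khom (rwhisker q'))) :
  rwhisker q = lwhisker p'.
Proof.
apply: (homotopy2_eqB B_free) => [|x Bx] /=; first exact: concatA.
by rewrite whiskr_B // whiskl_B //= whiskl_B // whiskr_B.
Qed.

(** On B, with k, k' the functions of a, b and u the derivation of [khom b], the sides are (u^-1 |>'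
    k) k' and k' ((u δ(k'))^-1 |>' k). They agree because δ(k') acts as conjugation by k'. *)
Lemma whisker_interchange a b (p : target (khom a) = hmap (khom b))
    (p' : target (khom a) = hmap (target2 b))
    (q : target (target2 a) = hmap (khom b))
    (q' : target (khom a) = hmap (khom b))
    (r : target2 (rwhisker p) = khom (lwhisker q))
    (r' : target2 (lwhisker q') = khom (rwhisker p')) :
  vcomp r = vcomp r'.
Proof.
apply: (homotopy2_eqB B_free) => [|x Bx] /=; first exact: concat_congr.
rewrite !whiskr_B // !whiskl_B //= invgM -(mfV delta) pactA pact_delta.
by rewrite !gnorm.
Qed.

Lemma is_whiskr_rwhisker a h (p : target (khom a) = hmap h) :
  is_whiskr B a h (concat p) (rwhisker p).
Proof.
split=> //; split=> [|k [kM kB]].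
  by split=> [|x Bx]; [exact: whiskr_2der | rewrite pactU; exact: whiskr_B].
suff /(congr1 (@kfun _ _)) : rwhisker p = Homotopy2 kM by [].
apply: (homotopy2_eqB B_free) => // x Bx /=.
by rewrite kB // pactU whiskr_B.
Qed.

Lemma is_whiskl_lwhisker a h (p : target h = hmap (khom a)) :
  is_whiskl B a (concat p) (lwhisker p).
Proof.
split=> //; split=> [|k [kM kB]].
  by split=> [|x Bx]; [exact: whiskl_2der | exact: whiskl_B].
suff /(congr1 (@kfun _ _)) : lwhisker p = Homotopy2 kM by [].
apply: (homotopy2_eqB B_free) => // x Bx /=.
by rewrite kB // whiskl_B.
Qed.

Definition homotopy_2category :
    strict_2category (xmod2_map C D) (homotopy C D) (homotopy2 C D) :=
  {| dom1 := @hmap C D; cod1 := @target C D; id1 := @id_homotopy C D;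
     comp1 f g p := concat p;
     dom1_id x := erefl; cod1_id := @target_id C D;
     dom1_comp f g p := erefl; cod1_comp f g p := target_concat B_free p;
     comp1_idl := concat_idl B_free; comp1_idr := concat_idr B_free;
     comp1A f g h p q p' q' := concatA p' q';
     dom2 := @khom C D; cod2 := @target2 C D;
     dom1_cod2 a := erefl; cod1_cod2 := @target_target2 C D;
     id2 := @id_homotopy2 C D; comp2 a b p := vcomp p;
     dom2_id f := erefl; cod2_id := @target2_id C D;
     dom2_comp a b p := erefl; cod2_comp := @target2_vcomp C D;
     comp2_idl := vcomp_idl; comp2_idr := vcomp_idr; comp2A := vcompA;
     whiskr a g p := rwhisker p;
     dom2_whiskr a g p := erefl;
     cod2_whiskr a g p := target2_whiskr B_free p;
     whiskr_id2 := rwhisker_id2; whiskr_comp2 := rwhisker_vcomp;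
     whiskr_id1 := rwhisker_id1; whiskr_comp1 := rwhisker_concat;
     whiskl f a p := lwhisker p;
     dom2_whiskl f a p := erefl;
     cod2_whiskl f a p := target2_whiskl B_free p;
     whiskl_id2 := lwhisker_id2; whiskl_comp2 := lwhisker_vcomp;
     whiskl_id1 := lwhisker_id1; whiskl_comp1 := lwhisker_concat;
     whisklr := rwhisker_lwhisker; Defs.interchange := whisker_interchange |}.

Lemma homotopy_2groupoid : is_2groupoid homotopy_2category.
Proof.
split=> [h | a]; first exact: concat_inv.
exists (vinv a), erefl, (target2_vinv a).
by split; [exact: vcomp_vinv | exact: vinv_vcomp].
Qed.
End TwoGroupoid.

Theorem theorem56 (A' A : xmod2) (B : set (grpG A')) (B_free : free_basis B) :
  exists X : strict_2category (xmod2_map A' A) (homotopy A' A) (homotopy2 A' A),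
    [/\ is_2groupoid X,
        (forall h, dom1 X h = hmap h /\ is_target h (cod1 X h)),
        (forall a, dom2 X a = khom a /\ is_target2 a (cod2 X a)),
        (forall h h' (p : cod1 X h = dom1 X h'),
           is_concat B h h' (comp1 X h h' p))
      & [/\ forall a b (p : cod2 X a = dom2 X b), is_vcomp a b (comp2 X a b p),
            forall a h (p : cod1 X (dom2 X a) = dom1 X h),
              is_whiskr B a h (comp1 X (dom2 X a) h p) (whiskr X a h p)
          & forall h a (p : cod1 X h = dom1 X (dom2 X a)),
              is_whiskl B a (comp1 X h (dom2 X a) p) (whiskl X h a p)]].
Proof.
exists (homotopy_2category A B_free); split=> //.
- exact: homotopy_2groupoid.
- by move=> h h' p; exact: is_concat_concat.
- split=> // [a h p | h a p]; first exact: is_whiskr_rwhisker.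
  exact: is_whiskl_lwhisker.
Qed.
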